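(* In the setting and under the regularity assumption of the context, fix $x\in\mathcal X$ and write $\ell_k(z)=\ell_k(x,z)$, $\ell(z)=\ell(x,z)$. The worst-case expectation problem $\max_{\mathbb Q\in\mathcal P}\mathbb E_{z\sim\mathbb Q}[\ell(z)]$ is equivalent to the nonconvex program $$\max\left\{\frac1N\sum_{i=1}^N\sum_{k=1}^K\alpha_{ik}\ell_k(\hat z_i+v_{ik})\;:\;\begin{array}{l}\alpha_{ik}\in\mathbb R_+,\ v_{ik}\in\mathbb R^m,\ \hat z_i+v_{ik}\in\mathcal Z\ \ \forall i\in[N],\forall k\in[K],\\ \frac1N\sum_{i=1}^N\sum_{k=1}^K\alpha_{ik}c(\hat z_i+v_{ik},\hat z_i)\le\rho,\ \ \sum_{k=1}^K\alpha_{ik}=1\ \forall i\in[N]\end{array}\right\}.$$ Given an optimal solution $\{\alpha^\star_{ik},v^\star_{ik}\}$ of this program, the discrete distribution $\mathbb Q^\star:=\frac1N\sum_{i=1}^N\sum_{k=1}^K\alpha^\star_{ik}\delta_{\hat z_i+v^\star_{ik}}$ belongs to $\mathcal P$ and attains the maximum in the worst-case expectation problem. Furthermore, there exists an optimal solution in which at most $N+1$ of the weights $\{\alpha^\star_{ik}\}$ are nonzero. Consequently, there exists a worst-case distribution $\mathbb Q^\star$ supported on at most $N+1$ points.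
   Context: Notation: $[n]=\{1,\dots,n\}$; $\mathcal P(\mathcal Z)$ is the set of Borel probability measures on $\mathcal Z$. Setting. $\mathcal X\subseteq\mathbb R^n$, $\mathcal Z\subseteq\mathbb R^m$. A transportation cost $c:\mathcal Z\times\mathcal Z\to\mathbb R_+$ is lower semicontinuous, satisfies $c(z,z)=0$ for all $z$, and $c(\cdot,\hat z)$ is convex for every fixed $\hat z\in\mathcal Z$. The optimal transport discrepancy is $\mathrm{OT}_c(\mathbb P,\mathbb Q)=\min_{\gamma}\mathbb E_{(z,\hat z)\sim\gamma}[c(z,\hat z)]$ over couplings $\gamma$ of $\mathbb P$ and $\mathbb Q$. Given $\hat z_1,\dots,\hat z_N\in\mathcal Z$, let $\hat{\mathbb P}=\frac1N\sum_{i=1}^N\delta_{\hat z_i}$; given $\rho>0$, let $\mathcal P=\{\mathbb P\in\mathcal P(\mathcal Z):\mathrm{OT}_c(\mathbb P,\hat{\mathbb P})\le\rho\}$. Regularity assumption. (i) $\mathcal X$ is nonempty and convex; there exist $\mathbb Q_0\in\mathcal P$ and $x_0\in\mathcal X$ such that $x\mapsto\mathbb E_{z\sim\mathbb Q_0}[\ell(x,z)]$ is inf-compact on $\mathcal X$ (all sublevel sets are compact) and $\mathbb E_{z\sim\mathbb Q_0}[\ell(x_0,z)]>-\infty$; $\mathcal Z$ is nonempty, closed and convex. (ii) $\ell(x,z)=\max_{k\in[K]}\ell_k(x,z)$ with $K\ge2$, where each $\ell_k:\mathbb R^n\times\mathbb R^m\to\mathbb R$ is real-valued, convex in its first and concave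 in its second argument. (iii) There exist a norm $\|\cdot\|$ on $\mathbb R^m$ and $p\ge1$ with $c(z,\hat z)\ge\|z-\hat z\|^p$ for all $z,\hat z\in\mathcal Z$; moreover, if $p=1$, then for every $x\in\mathcal X$ there exist $g>0$, $\hat z_0\in\mathcal Z$ and $r\in[0,1)$ such that $\ell(x,z)\le g[1+\|z-\hat z_0\|^r]$ for all $z\in\mathcal Z$. *)

(* Defs.v *)
From HB Require Import structures.
From mathcomp Require Import all_boot all_order all_algebra.
From mathcomp Require Import all_classical all_reals all_analysis.
Set Implicit Arguments.
Unset Strict Implicit.
Unset Printing Implicit Defensive.
Import Order.TTheory GRing.Theory Num.Theory.
Import numFieldNormedType.Exports.
Local Open Scope classical_set_scope.
Local Open Scope ring_scope.

(* R^m with its Borel sigma-algebra *)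
Notation borel R m := (g_sigma_algebraType (@open 'rV[R]_m)).

Definition is_norm (R : realType) (m : nat) (nrm : 'rV[R]_m -> R) : Prop :=
  [/\ forall u v, nrm (u + v) <= nrm u + nrm v,
      forall (a : R) u, nrm (a *: u) = `|a| * nrm u
    & forall u, nrm u = 0 -> u = 0].

(* A function on Z x Z is a total function whose values outside Z `*` Z are
   never used; lower semicontinuity is relative to the subspace Z `*` Z. *)
Record transportation_cost (R : realType) (m : nat) (Z : set 'rV[R]_m)
    (c : 'rV[R]_m -> 'rV[R]_m -> R) : Prop := TransportationCost {
  cost_ge0 : forall z zh, Z z -> Z zh -> 0 <= c z zh ;
  cost_lsc : lower_semicontinuous
    (fun w : subspace (Z `*` Z) => (c w.1 w.2)%:E) ;
  cost_diag : forall z, Z z -> c z z = 0 ;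
  cost_convex : forall zh, Z zh -> convex_function Z (c ^~ zh)
}.

Definition coupling (R : realType) (m : nat)
    (P Q : set (borel R m) -> \bar R)
    (gamma : probability (borel R m * borel R m)%type R) : Prop :=
  forall A : set (borel R m), measurable A ->
    gamma (A `*` setT) = P A /\ gamma (setT `*` A) = Q A.

Definition OT (R : realType) (m : nat) (Z : set 'rV[R]_m)
    (c : 'rV[R]_m -> 'rV[R]_m -> R)
    (P Q : set (borel R m) -> \bar R) : \bar R :=
  ereal_inf [set (\int[gamma]_(w in Z `*` Z) (c w.1 w.2)%:E)%E
            | gamma in coupling P Q].

Definition empirical (R : realType) (m N : nat) (zhat : 'I_N -> 'rV[R]_m)
    (A : set (borel R m)) : \bar R :=
  (\sum_(i < N) (N%:R^-1)%:E * \d_(zhat i : borel R m) A)%E.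

(* Borel probability measures on Z are those on R^m giving Z mass 1. *)
Definition ambiguity (R : realType) (m N : nat) (Z : set 'rV[R]_m)
    (c : 'rV[R]_m -> 'rV[R]_m -> R) (zhat : 'I_N -> 'rV[R]_m) (rho : R)
    : set (probability (borel R m) R) :=
  [set P : probability (borel R m) R |
    P Z = 1%E /\ (OT Z c P (empirical zhat) <= rho%:E)%E].

(* Equal to -oo when K = 0, finite otherwise. *)
Definition loss (R : realType) (n m K : nat)
    (l : 'I_K -> 'rV[R]_n -> 'rV[R]_m -> R)
    (x : 'rV[R]_n) (z : 'rV[R]_m) : \bar R :=
  \big[maxe/-oo%E]_(k < K) (l k x z)%:E.

(* If both the positive and the negative part have infinite integral, this is
   -oo; that cannot happen for Q in the ambiguity set and x in X under
   [regularity] below. *)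
Definition expected_loss (R : realType) (n m K : nat) (Z : set 'rV[R]_m)
    (l : 'I_K -> 'rV[R]_n -> 'rV[R]_m -> R)
    (Q : probability (borel R m) R) (x : 'rV[R]_n) : \bar R :=
  (\int[Q]_(z in Z) loss l x z)%E.

Definition inf_compact (R : realType) (n : nat) (X : set 'rV[R]_n)
    (f : 'rV[R]_n -> \bar R) : Prop :=
  forall t : R, compact [set x | X x /\ (f x <= t%:E)%E].

Record regularity (R : realType) (n m N K : nat)
    (X : set 'rV[R]_n) (Z : set 'rV[R]_m)
    (c : 'rV[R]_m -> 'rV[R]_m -> R) (zhat : 'I_N -> 'rV[R]_m) (rho : R)
    (l : 'I_K -> 'rV[R]_n -> 'rV[R]_m -> R) : Prop := Regularity {
  reg_X_neq0 : X !=set0 ;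
  reg_X_convex : convex_set X ;
  reg_inf_compact : exists (Q0 : probability (borel R m) R) (x0 : 'rV[R]_n),
    [/\ ambiguity Z c zhat rho Q0, X x0,
        inf_compact X (expected_loss Z l Q0)
      & (-oo < expected_loss Z l Q0 x0)%E] ;
  reg_Z_neq0 : Z !=set0 ;
  reg_Z_closed : closed Z ;
  reg_Z_convex : convex_set Z ;
  reg_K : (2 <= K)%N ;
  reg_loss_convex : forall k z, convex_function setT (l k ^~ z) ;
  reg_loss_concave : forall k x, convex_function setT (fun z => - l k x z) ;
  reg_growth : exists (nrm : 'rV[R]_m -> R) (p : R),
    [/\ is_norm nrm, 1 <= p,
        forall z zh, Z z -> Z zh -> nrm (z - zh) `^ p <= c z zh
      & p = 1 -> forall x, X x -> exists (g : R) (zh0 : 'rV[R]_m) (r : R),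
          [/\ 0 < g, Z zh0, 0 <= r < 1
            & forall z, Z z ->
                (loss l x z <= (g * (1 + nrm (z - zh0) `^ r))%:E)%E]]
}.

Definition worst_case (R : realType) (n m N K : nat) (Z : set 'rV[R]_m)
    (c : 'rV[R]_m -> 'rV[R]_m -> R) (zhat : 'I_N -> 'rV[R]_m) (rho : R)
    (l : 'I_K -> 'rV[R]_n -> 'rV[R]_m -> R) (x : 'rV[R]_n)
    (Q : probability (borel R m) R) : Prop :=
  ambiguity Z c zhat rho Q /\
  forall Q', ambiguity Z c zhat rho Q' ->
    (expected_loss Z l Q' x <= expected_loss Z l Q x)%E.

Definition feasible (R : realType) (m N K : nat) (Z : set 'rV[R]_m)
    (c : 'rV[R]_m -> 'rV[R]_m -> R) (zhat : 'I_N -> 'rV[R]_m) (rho : R)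
    (alpha : 'I_N -> 'I_K -> R) (v : 'I_N -> 'I_K -> 'rV[R]_m) : Prop :=
  [/\ forall i k, 0 <= alpha i k,
      forall i k, Z (zhat i + v i k),
      N%:R^-1 * (\sum_(i < N) \sum_(k < K)
        alpha i k * c (zhat i + v i k) (zhat i)) <= rho
    & forall i, \sum_(k < K) alpha i k = 1].

Definition objective (R : realType) (n m N K : nat)
    (zhat : 'I_N -> 'rV[R]_m) (l : 'I_K -> 'rV[R]_n -> 'rV[R]_m -> R)
    (x : 'rV[R]_n)
    (alpha : 'I_N -> 'I_K -> R) (v : 'I_N -> 'I_K -> 'rV[R]_m) : R :=
  N%:R^-1 * (\sum_(i < N) \sum_(k < K)
    alpha i k * l k x (zhat i + v i k)).

Definition optimal (R : realType) (n m N K : nat) (Z : set 'rV[R]_m)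
    (c : 'rV[R]_m -> 'rV[R]_m -> R) (zhat : 'I_N -> 'rV[R]_m) (rho : R)
    (l : 'I_K -> 'rV[R]_n -> 'rV[R]_m -> R) (x : 'rV[R]_n)
    (alpha : 'I_N -> 'I_K -> R) (v : 'I_N -> 'I_K -> 'rV[R]_m) : Prop :=
  feasible Z c zhat rho alpha v /\
  forall alpha' v', feasible Z c zhat rho alpha' v' ->
    objective zhat l x alpha' v' <= objective zhat l x alpha v.

Definition discrete_dist (R : realType) (m N K : nat)
    (zhat : 'I_N -> 'rV[R]_m)
    (alpha : 'I_N -> 'I_K -> R) (v : 'I_N -> 'I_K -> 'rV[R]_m)
    (A : set (borel R m)) : \bar R :=
  (\sum_(i < N) \sum_(k < K)
     (N%:R^-1 * alpha i k)%:E * \d_((zhat i + v i k)%R : borel R m) A)%E.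

(* Main.v *)
Require Import Defs.
From HB Require Import structures.
From mathcomp Require Import all_boot all_order all_algebra.
From mathcomp Require Import all_classical all_reals all_analysis.
From mathcomp Require Import measurable_realfun lra ring.
Set Implicit Arguments.
Unset Strict Implicit.
Unset Printing Implicit Defensive.
Import Order.TTheory GRing.Theory Num.Theory.
Import numFieldNormedType.Exports.
Local Open Scope classical_set_scope.
Local Open Scope ring_scope.

(* The finite program has a maximizer: along an ultrafilter of near-optimal points
   the weights converge, atoms of positive limit weight stay bounded because the cost
   is coercive, and atoms of vanishing weight contribute nothing because the loss
   grows slower than the cost. For fixed atoms the program is linear in the weights,
   with N + 1 constraints, so pivoting leaves at most N + 1 nonzero weights.
   Every feasible point gives a distribution in the ambiguity set with at least the
   same expected loss. Conversely, merging atoms shows that the value of the program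
   is concave in the budget rho, hence has a supergradient lam there; then
   l(z) <= lam c(z, zhat_i) + S(zhat_i) on Z, where the average of the S(zhat_i) is at
   most the value minus lam rho, and integrating against a nearly optimal coupling
   bounds the expected loss of any distribution in the ambiguity set. *)

(** * Convex functions on finite-dimensional space: boundedness, Lipschitz continuity, minorants *)

Lemma ler_coord_mx_norm (R : realType) (m : nat) (u : 'rV[R]_m) (j : 'I_m) :
  `|u 0 j| <= `|u|.
Proof.
have /mapP[i Hi ->] : `|u 0 j| \in [seq `|u x.1 x.2| | x : 'I_1 * 'I_m].
  by apply/mapP; exists (0, j) => //=; rewrite mem_enum.
by rewrite [leRHS]/Num.Def.normr /= mx_normrE; apply/bigmax_geP; right => /=; exists i.
Qed.

Lemma convex_functionE (R : realType) (E : lmodType R) (D : set E)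
    (f : E -> R) : convex_function D f ->
  forall s t x y, 0 <= s -> 0 <= t -> s + t = 1 -> D x -> D y ->
    f (s *: x + t *: y) <= s * f x + t * f y.
Proof.
move=> cf s t x y s0 t0 st Dx Dy.
have s1 : s <= 1 by rewrite -st lerDl.
have -> : t = 1 - s by rewrite -st addrAC subrr add0r.
have := cf (Itv01 s0 s1) x y (mem_set Dx) (mem_set Dy).
by rewrite /conv /=.
Qed.

Lemma convex_setE (R : realType) (E : lmodType R) (D : set E) :
  convex_set D ->
  forall s t x y, 0 <= s -> 0 <= t -> s + t = 1 -> D x -> D y ->
    D (s *: x + t *: y).
Proof.
move=> cD s t x y s0 t0 st Dx Dy.
have s1 : s <= 1 by rewrite -st lerDl.
have -> : t = 1 - s by rewrite -st addrAC subrr add0r.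
by have /set_mem := cD x y (Itv01 s0 s1) (mem_set Dx) (mem_set Dy).
Qed.

(* A segment is dominated by its endpoints, and a box by the midpoints of a
   segment in one coordinate and a box in the remaining ones. *)
Lemma convex_locally_bounded_above (R : realType) (m : nat)
    (f : 'rV[R]_m -> R) (x : 'rV[R]_m) : convex_function setT f ->
  exists M, forall u, `|u| <= 1 -> f (x + u) <= M.
Proof.
move=> /convex_functionE cf.
(* The induction adds one coordinate at a time and is stated for every radius, since each midpoint
   step doubles the remaining coordinates. *)
suff H (s : seq 'I_m) (r : R) : 0 < r ->
    exists M, forall t : 'I_m -> R, (forall j, `|t j| <= r) ->
      f (x + \sum_(j <- s) t j *: delta_mx 0 j) <= M.
  have [M HM] := H (index_enum _) 1 ltr01; exists M => u u1.
  rewrite [u]row_sum_delta; apply: HM => j.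
  exact: le_trans (ler_coord_mx_norm _ _) u1.
elim: s r => [|k s IH] r r0.
  by exists (f x) => t _; rewrite big_nil addr0.
have [|M HM] := IH (2 * r); first lra.
pose e : 'rV[R]_m := delta_mx 0 k.
pose M' := Num.max (f (x + (2 * r) *: e)) (f (x - (2 * r) *: e)).
exists (M / 2 + M' / 2) => t tr; rewrite big_cons.
set S := \sum_(j <- s) _.
have -> : x + (t k *: 'e_k + S) =
    2^-1 *: (x + \sum_(j <- s) (2 * t j) *: delta_mx 0 j)
    + 2^-1 *: (x + (2 * t k) *: e).
  under eq_bigr do rewrite -scalerA.
  rewrite -scaler_sumr -/S -/e !scalerDr !scalerA !mulVf ?pnatr_eq0//.
  rewrite !mulrA !mulVf ?pnatr_eq0// !mul1r scale1r.
  rewrite addrACA -scalerDl (_ : 2^-1 + 2^-1 = 1 :> R); last lra.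
  by rewrite scale1r (addrC S).
apply: le_trans (cf _ _ _ _ _ _ _ I I) _; [lra|lra|lra|].
rewrite ![2^-1 * _]mulrC lerD//; apply: ler_wpM2r; try lra.
  by apply: HM => j; rewrite normrM ger0_norm ?ler_wpM2l.
have := tr k; rewrite ler_norml => /andP[t1 t2].
(* As [t k] is at most [r] in absolute value, this point lies on the fixed segment whose endpoints
   define [M']. *)
have -> : x + (2 * t k) *: e =
    ((1 + t k / r) / 2) *: (x + (2 * r) *: e)
    + ((1 - t k / r) / 2) *: (x - (2 * r) *: e).
  set a := (1 + _) / 2; set b := (1 - _) / 2.
  have ab : a + b = 1 by rewrite /a /b; lra.
  have abr : (a - b) * (2 * r) = 2 * t k by rewrite /a /b; field; rewrite gt_eqF.
  by rewrite scalerDr scalerBr addrACA -scalerDl ab scale1r !scalerA -scalerBl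
    -mulrBl abr.
have ar : `|t k / r| <= 1.
  by rewrite normrM normfV (gtr0_norm r0) ler_pdivrMr// mul1r.
move: ar; rewrite ler_norml => /andP[a1 a2].
apply: le_trans (cf _ _ _ _ _ _ _ I I) _; [lra|lra|lra|].
have m1 : f (x + (2 * r) *: e) <= M' by rewrite le_max lexx.
have m2 : f (x - (2 * r) *: e) <= M' by rewrite le_max lexx orbT.
have p1 : 0 <= (1 + t k / r) / 2 by lra.
have p2 : 0 <= (1 - t k / r) / 2 by lra.
apply: le_trans (lerD (ler_wpM2l p1 m1) (ler_wpM2l p2 m2)) _.
by rewrite -mulrDl; lra.
Qed.

(** With [w] the normalised [u], the point [x + u] lies between [x] and [x + w], and [x] lies
    between [x - w] and [x + u]. The upper bound [M] at [x + w] and [x - w] therefore bounds the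
    increment from both sides, with constant [M - f x]. *)
Lemma convex_locally_lipschitz (R : realType) (m : nat)
    (f : 'rV[R]_m -> R) (x : 'rV[R]_m) : convex_function setT f ->
  exists2 C, 0 <= C & forall u, `|u| <= 1 -> `|f (x + u) - f x| <= C * `|u|.
Proof.
move=> cvf; have [M HM] := convex_locally_bounded_above x cvf.
move: cvf => /convex_functionE cf.
have M0 : f x <= M by have := HM 0; rewrite normr0 addr0; apply; exact: ler01.
exists (M - f x) => [|u u1]; first by rewrite subr_ge0.
have [->|u0] := eqVneq u 0; first by rewrite addr0 subrr !normr0 mulr0.
set e := `|u| in u1 *.
have e0 : 0 < e by rewrite normr_gt0.
pose w := e^-1 *: u.
have w1 : `|w| <= 1 by rewrite normrZ normfV normr_id mulVf// gt_eqF.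
have uw : u = e *: w by rewrite scalerA mulfV ?scale1r// gt_eqF.
have A1 := HM _ w1.
have A2 : f (x - w) <= M by apply: HM; rewrite normrN.
have B1 : f (x + u) <= e * f (x + w) + (1 - e) * f x.
  have -> : x + u = e *: (x + w) + (1 - e) *: x.
    by rewrite scalerDr -uw scalerBl scale1r [RHS]addrC addrA subrK.
  by apply: cf => //; lra.
have B2 : f x <= (1 + e)^-1 * f (x + u) + (e / (1 + e)) * f (x - w).
  have {1}-> : x = (1 + e)^-1 *: (x + u) + (e / (1 + e)) *: (x - w).
    rewrite [e / _]mulrC -scalerA -scalerDr scalerBr -uw addrACA subrr addr0.
    by rewrite -{2}[x]scale1r -scalerDl scalerA mulVf ?scale1r//; lra.
  apply: cf => //.
  - by rewrite invr_ge0; lra.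
  - by rewrite divr_ge0//; lra.
  - by field; lra.
have B3 : (1 + e) * f x <= f (x + u) + e * f (x - w).
  have e1 : 0 <= 1 + e by lra.
  apply: le_trans (ler_wpM2l e1 B2) _.
  by rewrite le_eqVlt; apply/orP; left; apply/eqP; field; lra.
have C1 := ler_wpM2l (ltW e0) A1.
have C2 := ler_wpM2l (ltW e0) A2.
by rewrite ler_norml; apply/andP; split; lra.
Qed.

Lemma convex_continuous (R : realType) (m : nat) (f : 'rV[R]_m -> R) :
  convex_function setT f -> continuous f.
Proof.
move=> cf x; have [C C0 HC] := convex_locally_lipschitz x cf.
apply/(@cvgrPdist_le _ _ _ (nbhs x)) => e e0.
have d0 : 0 < Num.min 1 (e / (C + 1)).
  by rewrite lt_min ltr01 divr_gt0//; lra.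
near=> y.
have yx : `|y - x| <= Num.min 1 (e / (C + 1)).
  by rewrite distrC; near: y; apply: cvgr_dist_le.
move: yx; rewrite le_min => /andP[y1 y2].
rewrite distrC; have := HC _ y1; rewrite (addrC x) subrK => /le_trans; apply.
apply: le_trans (ler_wpM2l C0 y2) _.
rewrite mulrA ler_pdivrMr; last lra.
by rewrite mulrDr mulr1 mulrC lerDl ltW.
Unshelve. all: by end_near. Qed.

(** Slopes of a convex function along a ray from [x] are nondecreasing, so the Lipschitz bound at
    distance 1 persists farther out. *)
Lemma convex_linear_minorant (R : realType) (m : nat)
    (f : 'rV[R]_m -> R) (x : 'rV[R]_m) : convex_function setT f ->
  exists2 C, 0 <= C & forall u, f x - C * `|u| <= f (x + u).
Proof.
move=> cvf; have [C C0 HC] := convex_locally_lipschitz x cvf.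
exists C => // u; move: cvf => /convex_functionE cf.
have [u1|u1] := leP `|u| 1.
  by have := HC _ u1; rewrite ler_norml => /andP[]; lra.
set e := `|u| in u1 *.
have e0 : 0 < e by lra.
pose w := e^-1 *: u.
have w1 : `|w| = 1 by rewrite normrZ normfV normr_id mulVf// gt_eqF.
have := HC w; rewrite w1 => /(_ (lexx _)).
rewrite ler_norml => /andP[A1 _].
have B : f (x + w) <= e^-1 * f (x + u) + (1 - e^-1) * f x.
  have -> : x + w = e^-1 *: (x + u) + (1 - e^-1) *: x.
    by rewrite scalerDr scalerBl scale1r [RHS]addrC addrA subrK.
  have ei : e^-1 <= 1 by rewrite invf_le1// ltW.
  have ei0 : 0 <= e^-1 by rewrite invr_ge0 ltW.
  by apply: cf => //; lra.
have D := ler_wpM2l (ltW e0) B.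
have E : e * (e^-1 * f (x + u) + (1 - e^-1) * f x) = f (x + u) + (e - 1) * f x.
  by field; rewrite gt_eqF.
rewrite E in D.
have F : e * (f x - C) <= e * f (x + w) by apply: ler_wpM2l; lra.
lra.
Qed.

(** * Norms, coercivity of the cost and growth of the loss *)

Lemma is_norm_ge0 (R : realType) (m : nat) (nrm : 'rV[R]_m -> R) :
  is_norm nrm -> forall u, 0 <= nrm u.
Proof.
move=> [tri hom _] u.
have n0 : nrm 0 = 0 by rewrite -(scale0r u) hom normr0 mul0r.
have := tri u (- u); rewrite subrr n0 -scaleN1r hom normrN1 mul1r; lra.
Qed.

Lemma is_norm_convex (R : realType) (m : nat) (nrm : 'rV[R]_m -> R) :
  is_norm nrm -> convex_function setT nrm.
Proof.
move=> [tri hom _] t x y _ _; rewrite /conv /=.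
apply: le_trans (tri _ _) _; rewrite !hom !ger0_norm//.
by rewrite subr_ge0; exact: le1.
Qed.

(** A norm is convex, hence continuous, and [k] is its minimum over the compact unit sphere. *)
Lemma is_norm_equivalence (R : realType) (m : nat) (nrm : 'rV[R]_m -> R) :
  is_norm nrm -> exists2 k, 0 < k & forall u, k * `|u| <= nrm u.
Proof.
move=> hn; have n0 := is_norm_ge0 hn; have nc := convex_continuous (is_norm_convex hn).
case: hn => tri hom pos.
pose S := [set u : 'rV[R]_m | `|u| = 1].
(* An empty sphere leaves only the zero vector, as for [m = 0], and any constant works. *)
have [S0|/set0P S0] := eqVneq S set0.
  exists 1 => // u; have [->|u0] := eqVneq u 0.
    by rewrite normr0 mulr0 n0.
  have : S (`|u|^-1 *: u).
    by rewrite /S/= normrZ normfV normr_id mulVf// normr_eq0.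
  by rewrite S0.
have cS : compact S.
  apply: bounded_closed_compact.
    exists 1; split; first exact: num_real.
    by move=> M M1 u /= ->; exact: ltW.
  apply: (@closed_comp _ _ (fun u : 'rV[R]_m => `|u|) [set 1]).
    by move=> u _; exact: norm_continuous.
  exact: closed_eq.
have [u0 /set_mem u0S Hu0] := EVT_min_rV S0 cS (continuous_subspaceT nc).
exists (nrm u0).
  rewrite lt_neqAle n0 andbT eq_sym; apply/eqP => /pos u00.
  by move: u0S; rewrite /S/= u00 normr0 => /esym/eqP; rewrite oner_eq0.
move=> u; have [->|u1] := eqVneq u 0; first by rewrite normr0 mulr0 n0.
have u2 : 0 < `|u| by rewrite normr_gt0.
have /Hu0 : `|u|^-1 *: u \in S.
  by rewrite inE /S/= normrZ normfV normr_id mulVf// gt_eqF.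
by rewrite hom normfV normr_id mulrC ler_pdivlMr// mulrC mulrC.
Qed.

Lemma powR_domination (R : realType) (r p B e : R) :
  0 <= r -> r < p -> 0 <= B -> 0 < e ->
  exists M, forall s, 0 <= s -> B * s `^ r <= M + e * s `^ p.
Proof.
move=> r0 rp B0 e0.
have pr : 0 < p - r by rewrite subr_gt0.
pose T := Num.max 1 ((B / e) `^ (p - r)^-1).
have T1 : 1 <= T by rewrite le_max lexx.
have T0 : 0 <= T := le_trans ler01 T1.
have Be : 0 <= B / e by rewrite divr_ge0 ?(ltW e0).
have TB : B / e <= T `^ (p - r).
  have {1}-> : B / e = ((B / e) `^ (p - r)^-1) `^ (p - r).
    by rewrite -powRrM mulVf ?gt_eqF// powRr1.
  by apply: ge0_ler_powR; rewrite ?nnegrE ?powR_ge0 ?(ltW pr)// le_max lexx orbT.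
exists (B * T `^ r) => s s0.
have [sT|Ts] := leP s T.
  rewrite -[leLHS]addr0 lerD ?mulr_ge0 ?powR_ge0 ?(ltW e0)//.
  by rewrite ler_wpM2l// ge0_ler_powR ?nnegrE.
rewrite -[leLHS]add0r lerD ?mulr_ge0 ?powR_ge0//.
have s1 : s != 0 by rewrite gt_eqF// (lt_trans _ Ts)// (lt_le_trans ltr01).
have -> : s `^ p = s `^ (p - r) * s `^ r.
  by rewrite -powRD ?subrK// s1 implybT.
rewrite mulrA ler_wpM2r ?powR_ge0//.
rewrite -ler_pdivrMl// mulrC (le_trans TB)// ge0_ler_powR ?nnegrE ?(ltW pr)//.
exact: ltW.
Qed.

Lemma cost_coercive (R : realType) (m : nat) (Z : set 'rV[R]_m)
    (c : 'rV[R]_m -> 'rV[R]_m -> R) (nrm : 'rV[R]_m -> R) (p : R)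
    (y : 'rV[R]_m) (M : R) :
  closed Z -> is_norm nrm -> 1 <= p -> Z y ->
  (forall z zh, Z z -> Z zh -> nrm (z - zh) `^ p <= c z zh) ->
  exists A, [/\ compact A, A `<=` Z & forall z, Z z -> c z y <= M -> A z].
Proof.
move=> cZ hn p1 Zy hc; have [k k0 hk] := is_norm_equivalence hn.
have n0 := is_norm_ge0 hn.
(* The maximum with 1 is there because [nrm (z - y)] is bounded by its [p]-th power only when it is
   at least 1. *)
pose B := Num.max 1 M / k.
exists (Z `&` [set z | `|z - y| <= B]); split => [||z Zz zM].
- apply: bounded_closed_compact.
    exists (`|y| + B); split; first exact: num_real.
    move=> r rB u [_ /= uB]; apply: le_trans (ltW rB).
    by rewrite -[u](subrK y) addrC (le_trans (ler_normD _ _))// lerD2l.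
  apply: closedI => //.
  apply: (@closed_comp _ _ (fun u : 'rV[R]_m => `|u - y|) [set r | r <= B]).
    move=> u _; apply: continuous_comp; last exact: norm_continuous.
    apply: (@continuousB _ _ _ id (cst y)); first exact: cvg_id.
    exact: cst_continuous.
  exact: closed_le.
- by move=> z [].
- split => //=; rewrite /B ler_pdivlMr// mulrC (le_trans (hk _))//.
  rewrite le_max; case: (leP (nrm (z - y)) 1) => //= n1.
  apply: le_trans zM; apply: le_trans (hc _ _ Zz Zy).
  by apply: le1r_powR => //; exact: ltW.
Qed.

Lemma ler_loss (R : realType) (n m K : nat)
    (l : 'I_K -> 'rV[R]_n -> 'rV[R]_m -> R) x z k :
  ((l k x z)%:E <= loss l x z)%E.
Proof. exact: (le_bigmax _ (fun k => (l k x z)%:E)). Qed.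

(* For p > 1 concavity alone gives linear, hence sub-p, growth. *)
Lemma loss_growth (R : realType) (n m N K : nat)
    (X : set 'rV[R]_n) (Z : set 'rV[R]_m)
    (c : 'rV[R]_m -> 'rV[R]_m -> R) (zhat : 'I_N -> 'rV[R]_m) (rho : R)
    (l : 'I_K -> 'rV[R]_n -> 'rV[R]_m -> R) (x : 'rV[R]_n) :
  regularity X Z c zhat rho l -> X x ->
  forall k y e, Z y -> 0 < e ->
  exists M, forall z, Z z -> l k x z <= M + e * c z y.
Proof.
move=> hreg hx k y e Zy e0.
have [nrm [p [hn p1 hc h1]]] := reg_growth hreg.
have n0 := is_norm_ge0 hn.
have [/esym pE|p1'] := eqVneq 1 p.
  have [g [z0 [r [g0 Zz0 /andP[r0 r1] hg]]]] := h1 pE x hx.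
  have [M HM] := powR_domination r0 r1 (ltW g0) e0.
  (* The growth bound is centred at [z0] and the cost at [y]; the triangle inequality moves the
     centre at the price of the last summand. *)
  exists (g + M + e * nrm (y - z0)) => z Zz.
  have := le_trans (ler_loss l x z k) (hg _ Zz); rewrite lee_fin => /le_trans; apply.
  have := HM _ (n0 (z - z0)); rewrite powRr1// => A.
  have B : nrm (z - z0) <= nrm (z - y) + nrm (y - z0).
    by case: hn => tri _ _; have := tri (z - y) (y - z0); rewrite addrA subrK.
  have C := hc _ _ Zz Zy; rewrite pE powRr1// in C.
  have D := ler_wpM2l (ltW e0) (le_trans B (lerD C (lexx _))).
  lra.
have {p1'}p1 : 1 < p by rewrite lt_neqAle p1' p1.
have [k0 k00 hk] := is_norm_equivalence hn.
have [C C0 HC] := convex_linear_minorant y (reg_loss_concave hreg k x).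
have [|M HM] := @powR_domination R 1 p (C / k0) e ler01 p1 _ e0.
  by rewrite divr_ge0// ltW.
exists (l k x y + M) => z Zz.
have A := HC (z - y); rewrite (addrC y) subrK in A.
have := HM _ (n0 (z - y)); rewrite powRr1// => B.
have D := ler_wpM2l (ltW e0) (hc _ _ Zz Zy).
have E : C * `|z - y| <= C / k0 * nrm (z - y).
  by rewrite -mulrA ler_wpM2l// mulrC ler_pdivlMr// mulrC.
lra.
Qed.

Lemma loss_continuous (R : realType) (n m N K : nat)
    (X : set 'rV[R]_n) (Z : set 'rV[R]_m)
    (c : 'rV[R]_m -> 'rV[R]_m -> R) (zhat : 'I_N -> 'rV[R]_m) (rho : R)
    (l : 'I_K -> 'rV[R]_n -> 'rV[R]_m -> R) (x : 'rV[R]_n) :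
  regularity X Z c zhat rho l -> forall k, continuous (l k x).
Proof.
move=> hreg k z; rewrite -[l k x]opprK; apply: continuousN.
exact: (convex_continuous (reg_loss_concave hreg k x)).
Qed.

(** * Limits of atoms along an ultrafilter *)

(** Compactness gives a cluster point; an ultrafilter contains the preimage of each neighbourhood or
    of its complement, and clustering rules out the latter. *)
Lemma ultra_compact_cvg (T : Type) (W : topologicalType) (U : set_system T)
    (UU : UltraFilter U) (f : T -> W) (A : set W) :
  compact A -> U (f @^-1` A) -> exists2 p, A p & f @ U --> p.
Proof.
move=> cA UA; have [p [Ap clp]] := cA (f @ U) _ UA.
exists p => // V Vp; rewrite /= nbhs_filterE.
have [//|nV] := in_ultra_setVsetC (f @^-1` V) UU.
have [q [nVq Vq]] := clp (~` V) V nV Vp.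
by case: nVq.
Qed.

Lemma cost_lsc_at (R : realType) (m : nat) (Z : set 'rV[R]_m)
    (c : 'rV[R]_m -> 'rV[R]_m -> R) (y z0 : 'rV[R]_m) (b : R) :
  transportation_cost Z c -> Z y -> Z z0 -> b < c z0 y ->
  \forall z \near z0, Z z -> b < c z y.
Proof.
move=> hc Zy Zz0 bc.
have [|V + HV] := @cost_lsc _ _ _ _ hc (z0, y) b; first by rewrite lte_fin.
rewrite /nbhs/= -nbhs_subspace_in// => -[[V1 V2] [/= V1z V2y] sV].
near=> z => Zz.
have := HV (z, y); rewrite lte_fin; apply; apply: (sV (z, y)) => //.
by split => /=; [near: z|exact: nbhs_singleton].
Unshelve. all: by end_near. Qed.

(* An atom of vanishing weight may escape to infinity, but then it carries no loss
   in the limit, so it can be moved to [y] at no cost. *)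
Lemma atom_limit (R : realType) (m : nat) (Z : set 'rV[R]_m)
    (c : 'rV[R]_m -> 'rV[R]_m -> R) (y : 'rV[R]_m) (f : 'rV[R]_m -> R)
    (T : Type) (U : set_system T) (UU : UltraFilter U)
    (a : T -> R) (z : T -> 'rV[R]_m) (B : R) :
  transportation_cost Z c -> Z y -> continuous f -> 0 < B ->
  (forall M, exists A,
    [/\ compact A, A `<=` Z & forall z, Z z -> c z y <= M -> A z]) ->
  (forall e, 0 < e -> exists M, forall z, Z z -> f z <= M + e * c z y) ->
  (\forall t \near U, [/\ 0 <= a t, a t <= 1, Z (z t) & a t * c (z t) y <= B]) ->
  exists a0 z0, [/\ 0 <= a0, Z z0 & forall d, 0 < d -> \forall t \near U,
    [/\ `|a t - a0| <= d, a0 * c z0 y - d <= a t * c (z t) y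
      & a t * f (z t) <= a0 * f z0 + d]].
Proof.
move=> hc Zy fc B0 coer grow UaZ.
have [a0 a01 aa0] : exists2 a0 : R, `[0, 1]%classic a0 & a @ U --> a0.
  apply: ultra_compact_cvg; first exact: segment_compact.
  by apply: filterS UaZ => t [? ? _ _] /=; rewrite in_itv/=; apply/andP.
have a00 : 0 <= a0 by move: a01; rewrite /= in_itv/= => /andP[].
have [a0E|a0p] := eqVneq a0 0.
  exists a0, y; split => // d d0; rewrite a0E !mul0r add0r.
  (* Growth with this slope bounds the loss term by [a t * M + d / 2], and the first summand
     vanishes with [a t]. *)
  have eB : 0 < d / (2 * B) by rewrite divr_gt0// mulr_gt0.
  have [M HM] := grow _ eB.
  have M1 : 0 < d / (2 * (`|M| + 1)).
    by rewrite divr_gt0// mulr_gt0// ltr_wpDl.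
  have aw w : 0 < w -> \forall t \near U, a t <= w.
    by rewrite -a0E => /(cvgr_lt _ aa0); apply: filterS => t /ltW.
  near=> t.
  have [t0 t1 Zt tB] : [/\ 0 <= a t, a t <= 1, Z (z t) & a t * c (z t) y <= B].
    by near: t.
  have td : a t <= d.
    by near: t; exact: aw.
  have tM : a t <= d / (2 * (`|M| + 1)).
    by near: t; exact: aw.
  split.
  - by rewrite subr0 ger0_norm.
  - have := mulr_ge0 t0 (cost_ge0 hc Zt Zy); lra.
  - apply: le_trans (ler_wpM2l t0 (HM _ Zt)) _.
    rewrite mulrDr mulrCA.
    have M0 : 0 < 2 * (`|M| + 1) by rewrite mulr_gt0// ltr_wpDl.
    have C1 : a t * M <= d / 2.
      apply: le_trans (ler_wpM2l t0 (ler_norm M)) _.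
      move: tM; rewrite ler_pdivlMr// => tM.
      by rewrite ler_pdivlMr//; apply: le_trans tM; nra.
    have C2 : d / (2 * B) * (a t * c (z t) y) <= d / 2.
      apply: le_trans (ler_wpM2l (ltW eB) tB) _.
      by rewrite le_eqVlt; apply/orP; left; apply/eqP; field; rewrite gt_eqF.
    lra.
have {a0p}a0p : 0 < a0 by rewrite lt_neqAle eq_sym a0p.
(* Eventually [a t] exceeds [a0 / 2], so the bound [B] on the weighted cost keeps the cost itself
   below this level. *)
have [A [cA AZ HA]] := coer (2 * B / a0).
have [z0 Az0 zz0] : exists2 z0, A z0 & z @ U --> z0.
  apply: ultra_compact_cvg => //; rewrite /preimage/=.
  near=> t.
  have [t0 t1 Zt tB] : [/\ 0 <= a t, a t <= 1, Z (z t) & a t * c (z t) y <= B].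
    by near: t.
  have ta : a0 / 2 < a t by near: t; apply: (cvgr_gt _ aa0); lra.
  apply: HA => //; rewrite ler_pdivlMr//.
  by have := cost_ge0 hc Zt Zy; nra.
have Zz0 := AZ _ Az0.
exists a0, z0; split => // d d0.
(* Lowering [c z0 y] by [e] loses [a0 * e], and the convergence of the product takes another [e];
   together they make [d]. *)
pose e := d / (a0 + 1).
have e0 : 0 < e by rewrite divr_gt0// ltr_wpDl.
have eE : e * (a0 + 1) = d by rewrite /e divfK// gt_eqF// ltr_wpDl.
have afc : a t * f (z t) @[t --> U] --> a0 * f z0.
  by apply: cvgM => //; apply: continuous_cvg => //; exact: fc.
have acc : a t * (c z0 y - e) @[t --> U] --> a0 * (c z0 y - e).
  by apply: cvgM => //; exact: cvg_cst.
have clsc : \forall t \near U, Z (z t) -> c z0 y - e < c (z t) y.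
  apply: (zz0 [set z | Z z -> c z0 y - e < c z y]).
  by apply: cost_lsc_at => //; lra.
near=> t.
have [t0 t1 Zt tB] : [/\ 0 <= a t, a t <= 1, Z (z t) & a t * c (z t) y <= B].
  by near: t.
split.
- by rewrite distrC; near: t; exact: (cvgr_dist_le _ _ aa0).
- have H1 : c z0 y - e < c (z t) y by move: Zt; near: t.
  have H2 : a0 * (c z0 y - e) - e < a t * (c z0 y - e).
    by near: t; apply: (cvgr_gt _ acc); lra.
  have H3 := ler_wpM2l t0 (ltW H1).
  apply: le_trans H3; apply: le_trans (ltW H2); nra.
- by apply: ltW; near: t; apply: (cvgr_lt _ afc); lra.
Unshelve. all: by end_near. Qed.

(** * Feasible points and existence of a maximizer *)

Lemma ler_average_perturbation (R : realType) (N K : nat)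
    (F G : 'I_N -> 'I_K -> R) (d : R) : (0 < N)%N ->
  (forall i k, F i k <= G i k + d) ->
  N%:R^-1 * (\sum_(i < N) \sum_(k < K) F i k)
    <= N%:R^-1 * (\sum_(i < N) \sum_(k < K) G i k) + K%:R * d.
Proof.
move=> N0 FG; have N1 : (0 : R) < N%:R by rewrite ltr0n.
have -> : K%:R * d = N%:R^-1 * \sum_(i < N) \sum_(k < K) d.
  rewrite !sumr_const !card_ord -(mulr_natl (d *+ K) N) -(mulr_natl d K) mulKf//.
  by rewrite gt_eqF.
rewrite -mulrDr -big_split /= ler_wpM2l ?invr_ge0 ?ler0n//.
by apply: ler_sum => i _; rewrite -big_split /=; apply: ler_sum => k _; exact: FG.
Qed.

Lemma feasible_alpha_le1 (R : realType) (m N K : nat) (Z : set 'rV[R]_m)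
    (c : 'rV[R]_m -> 'rV[R]_m -> R) (zhat : 'I_N -> 'rV[R]_m) (rho : R)
    alpha (v : 'I_N -> 'I_K -> 'rV[R]_m) :
  feasible Z c zhat rho alpha v -> forall i k, alpha i k <= 1.
Proof.
move=> [a0 _ _ a1] i k; rewrite -(a1 i) (bigD1 k)//= lerDl.
by apply: sumr_ge0.
Qed.

(** The budget sum has nonnegative terms, so each one is at most the whole. This supplies the bound
    [B] of [atom_limit]. *)
Lemma feasible_atom_cost (R : realType) (m N K : nat) (Z : set 'rV[R]_m)
    (c : 'rV[R]_m -> 'rV[R]_m -> R) (zhat : 'I_N -> 'rV[R]_m) (rho : R)
    alpha (v : 'I_N -> 'I_K -> 'rV[R]_m) :
  (0 < N)%N -> transportation_cost Z c -> (forall i, Z (zhat i)) ->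
  feasible Z c zhat rho alpha v ->
  forall i k, alpha i k * c (zhat i + v i k) (zhat i) <= N%:R * rho.
Proof.
move=> N0 hc hz [a0 Zv arho _] i k; have N1 : (0 : R) < N%:R by rewrite ltr0n.
rewrite -ler_pdivrMl//; apply: le_trans arho.
rewrite ler_wpM2l ?invr_ge0 ?ler0n//.
have p i' k' : 0 <= alpha i' k' * c (zhat i' + v i' k') (zhat i').
  by rewrite mulr_ge0// (cost_ge0 hc).
rewrite (bigD1 i)//= (bigD1 k)//= -addrA lerDl addr_ge0//.
  exact: sumr_ge0.
by apply: sumr_ge0 => j _; exact: sumr_ge0.
Qed.

(** These are the test points of the program: sample [i] sends its whole weight to [zf i] under
    index [kf i]. They show feasibility for every nonnegative budget and later probe the dual
    function. *)
Lemma feasible_single_atoms (R : realType) (n m N K : nat) (Z : set 'rV[R]_m)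
    (c : 'rV[R]_m -> 'rV[R]_m -> R) (zhat : 'I_N -> 'rV[R]_m) (rho : R)
    (l : 'I_K -> 'rV[R]_n -> 'rV[R]_m -> R) (x : 'rV[R]_n)
    (kf : 'I_N -> 'I_K) (zf : 'I_N -> 'rV[R]_m) :
  (forall i, Z (zf i)) -> N%:R^-1 * \sum_(i < N) c (zf i) (zhat i) <= rho ->
  exists alpha v, feasible Z c zhat rho alpha v /\
    objective zhat l x alpha v = N%:R^-1 * \sum_(i < N) l (kf i) x (zf i).
Proof.
move=> Zf crho.
have sumE (F : 'I_N -> 'I_K -> R) i : \sum_(k < K) (k == kf i)%:R * F i k = F i (kf i).
  rewrite (bigD1 (kf i))//= eqxx mul1r big1 ?addr0// => k /negbTE ->.
  by rewrite mul0r.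
exists (fun i k => (k == kf i)%:R), (fun i _ => zf i - zhat i).
have zE i : zhat i + (zf i - zhat i) = zf i by rewrite addrC subrK.
split; last first.
  rewrite /objective; congr (_ * _); apply: eq_bigr => i _.
  by rewrite (sumE (fun i k => l k x _)) zE.
split.
- by move=> i k; rewrite ler0n.
- by move=> i _; rewrite zE.
- apply: le_trans crho; rewrite le_eqVlt; apply/orP; left; apply/eqP.
  congr (_ * _); apply: eq_bigr => i _.
  by rewrite (sumE (fun i k => c _ _)) zE.
- move=> i; rewrite -[RHS](sumE (fun _ _ => 1) i).
  by apply: eq_bigr => k _; rewrite mulr1.
Qed.

(** The growth bound with slope 1 dominates the objective by constants plus the average cost, which
    is at most [rho]. *)
Lemma feasible_objective_bounded (R : realType) (n m N K : nat)
    (X : set 'rV[R]_n) (Z : set 'rV[R]_m)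
    (c : 'rV[R]_m -> 'rV[R]_m -> R) (zhat : 'I_N -> 'rV[R]_m) (rho : R)
    (l : 'I_K -> 'rV[R]_n -> 'rV[R]_m -> R) (x : 'rV[R]_n) :
  (0 < N)%N -> transportation_cost Z c -> (forall i, Z (zhat i)) ->
  regularity X Z c zhat rho l -> X x ->
  exists B, forall alpha v, feasible Z c zhat rho alpha v ->
    objective zhat l x alpha v <= B.
Proof.
move=> N0 hc hz hreg hx.
have [M HM] := choice (fun ik : 'I_N * 'I_K =>
  loss_growth hreg hx ik.2 (hz ik.1) ltr01).
exists (N%:R^-1 * (\sum_(i < N) \sum_(k < K) `|M (i, k)|) + rho) => alpha v fav.
have a1 := feasible_alpha_le1 fav.
case: fav => [a0 Zv arho _].
apply: le_trans (lerD (lexx _) arho).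
rewrite /objective -mulrDr ler_wpM2l ?invr_ge0 ?ler0n//.
rewrite -big_split /=; apply: ler_sum => i _.
rewrite -big_split /=; apply: ler_sum => k _ /=.
have := ler_wpM2l (a0 i k) (HM (i, k) _ (Zv i k)); rewrite mul1r mulrDr.
move=> /le_trans; apply; rewrite lerD2r.
apply: le_trans (ler_wpM2l (a0 i k) (ler_norm _)) _.
by rewrite ler_piMl.
Qed.

Lemma exists_optimal (R : realType) (n m N K : nat)
    (X : set 'rV[R]_n) (Z : set 'rV[R]_m)
    (c : 'rV[R]_m -> 'rV[R]_m -> R) (zhat : 'I_N -> 'rV[R]_m) (rho : R)
    (l : 'I_K -> 'rV[R]_n -> 'rV[R]_m -> R) (x : 'rV[R]_n) :
  (0 < N)%N -> transportation_cost Z c -> (forall i, Z (zhat i)) ->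
  0 < rho -> regularity X Z c zhat rho l -> X x ->
  exists alpha v, optimal Z c zhat rho l x alpha v.
Proof.
move=> N0 hc hz hrho hreg hx.
have N1 : (0 : R) < N%:R by rewrite ltr0n.
have K0 : (0 < K)%N := ltn_trans (ltn0Sn 0) (reg_K hreg).
have K1 : (0 : R) < K%:R by rewrite ltr0n.
pose T := (('I_N -> 'I_K -> R) * ('I_N -> 'I_K -> 'rV[R]_m))%type.
pose ob (t : T) := objective zhat l x t.1 t.2.
pose S := [set t : T | feasible Z c zhat rho t.1 t.2].
have [B HB] := feasible_objective_bounded N0 hc hz hreg hx.
have hsup : has_sup (ob @` S).
  split; last by exists B => _ [t St <-]; exact: HB.
  have [||alpha [v [fav _]]] := @feasible_single_atoms R n m N K Z c zhat rho l x
    (fun=> Ordinal K0) zhat => //.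
    by rewrite big1 ?mulr0 ?ltW// => i _; rewrite (cost_diag hc).
  by exists (ob (alpha, v)), (alpha, v).
pose V := sup (ob @` S).
(* The sets of feasible points within [e] of the supremum form a filter base. An ultrafilter above
   it makes all weights converge at once. *)
have [U [UU sU]] : exists U, UltraFilter U /\
    filter_from [set e : R | 0 < e] (fun e => [set t | S t /\ V - e < ob t]) `<=` U.
  apply: ultraFilterLemma; apply: filter_from_proper.
    apply: filter_from_filter; first by exists 1 => /=.
    move=> e f /= e0 f0; exists (Num.min e f); first by rewrite /= lt_min e0.
    move=> t [St Vt]; split; split => //; apply: le_lt_trans Vt;
      by rewrite lerD2l lerN2 ge_min lexx ?orbT.
  move=> e /= e0; have [_ [t St <-] Ht] := sup_adherent e0 hsup.
  by exists t.
have Unear e : 0 < e -> \forall t \near U, S t /\ V - e < ob t.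
  by move=> e0; apply: sU; exists e.
have US : \forall t \near U, S t by apply: filterS (Unear _ ltr01) => t [].
have [nrm [p [hn p1 hcp _]]] := reg_growth hreg.
pose close d (ik : 'I_N * 'I_K) (az : R * 'rV[R]_m) (t : T) :=
  [/\ `|t.1 ik.1 ik.2 - az.1| <= d,
      az.1 * c az.2 (zhat ik.1) - d
        <= t.1 ik.1 ik.2 * c (zhat ik.1 + t.2 ik.1 ik.2) (zhat ik.1)
    & t.1 ik.1 ik.2 * l ik.2 x (zhat ik.1 + t.2 ik.1 ik.2)
        <= az.1 * l ik.2 x az.2 + d].
pose P (ik : 'I_N * 'I_K) (az : R * 'rV[R]_m) :=
  [/\ 0 <= az.1, Z az.2 &
      forall d, 0 < d -> \forall t \near U, close d ik az t].
have [az Haz] : {az & forall ik, P ik (az ik)}.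
  apply: (@choice _ _ P) => -[i k].
  have lc := @loss_continuous _ _ _ _ _ _ _ _ _ _ _ x hreg k.
  have [||||a0 [z0 Haz]] := @atom_limit R m Z c (zhat i) (l k x) T U UU
      (fun t => t.1 i k) (fun t => zhat i + t.2 i k) (N%:R * rho)
      hc (hz i) lc.
  - by rewrite mulr_gt0.
  - by move=> M; apply: cost_coercive hn p1 (hz i) hcp; exact: reg_Z_closed hreg.
  - by move=> e e0; exact: loss_growth hreg hx _ _ _ (hz i) e0.
  - apply: filterS US => t St.
    have t1 := feasible_alpha_le1 St.
    have tc := feasible_atom_cost N0 hc hz St.
    by case: St => a0 Zt _ _; split.
  by exists (a0, z0).
(* There are finitely many pairs, so a single near-optimal feasible [t] is close to the limit at all
   of them; each property of the limit follows by comparison with such a [t]. *)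
have near_all d : 0 < d -> exists t,
    [/\ S t, V - d < ob t & forall ik, close d ik (az ik) t].
  move=> d0; apply: (@filter_ex _ U).
  have H : \forall t \near U, forall ik, close d ik (az ik) t.
    by apply: filter_forall => ik; have [_ _] := Haz ik; exact.
  near=> t; have [St Vt] : S t /\ V - d < ob t by near: t; exact: Unear.
  by split => //; near: t.
pose alpha i k := (az (i, k)).1.
pose v i k := (az (i, k)).2 - zhat i.
have zvE i k : zhat i + v i k = (az (i, k)).2 by rewrite /v addrC subrK.
exists alpha, v; split.
  split.
  - by move=> i k; have [] := Haz (i, k).
  - by move=> i k; rewrite zvE; have [] := Haz (i, k).
  - apply/ler_addgt0Pr => e e0.
    have [t [[_ _ arho _] _ Ht]] := near_all (e / K%:R) (divr_gt0 e0 K1).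
    have -> : e = K%:R * (e / K%:R) by rewrite [RHS]mulrC divfK// gt_eqF.
    apply: le_trans (lerD arho (lexx _)).
    apply: ler_average_perturbation => // i k.
    by rewrite zvE -lerBlDr; have [] := Ht (i, k).
  - move=> i; apply/eqP; rewrite -subr_eq0 -normr_le0; apply/ler_addgt0Pr => e e0.
    have [t [[_ _ _ a1] _ Ht]] := near_all (e / K%:R) (divr_gt0 e0 K1).
    rewrite add0r -(a1 i) -sumrB (le_trans (ler_norm_sum _ _ _))//.
    have -> : e = \sum_(k < K) (e / K%:R).
      by rewrite sumr_const card_ord -[RHS]mulr_natr divfK// gt_eqF.
    by apply: ler_sum => k _; rewrite distrC; have [] := Ht (i, k).
move=> alpha' v' fav'.
have : ob (alpha', v') <= V by apply: sup_upper_bound => //; exists (alpha', v').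
move=> /le_trans; apply; apply/ler_addgt0Pr => e e0.
(* The error is split into [K] shares for the atoms and one for the gap between [ob t] and the
   supremum. *)
have d0 : 0 < e / (K%:R + 1) by rewrite divr_gt0// ltr_wpDl// ltW.
have [t [_ Vt Ht]] := near_all _ d0.
have -> : e = K%:R * (e / (K%:R + 1)) + e / (K%:R + 1).
  by field; rewrite gt_eqF// ltr_wpDl// ltW.
rewrite addrA -lerBlDr; apply: le_trans (ltW Vt) _.
apply: ler_average_perturbation => // i k.
by rewrite zvE; have [] := Ht (i, k).
Unshelve. all: by end_near. Qed.

(** * Sparse optimal solutions by pivoting *)

(** The matrix with rows indexed by [D] has more rows than columns, hence a nonzero left kernel
    vector, which is extended by zero outside [D]. *)
Lemma exists_dependency (F : fieldType) (I : finType) (D : {set I}) (q : nat)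
    (A : I -> 'I_q -> F) : (q < #|D|)%N ->
  exists d : I -> F, [/\ exists i, d i != 0, forall i, d i != 0 -> i \in D
    & forall j, \sum_i d i * A i j = 0].
Proof.
move=> qD; pose M : 'M[F]_(#|D|, q) := \matrix_(a, j) A (enum_val a) j.
have : kermx M != 0.
  rewrite -mxrank_eq0 mxrank_ker subn_eq0 -ltnNge.
  exact: leq_ltn_trans (rank_leq_col _) qD.
case/rowV0Pn => u /sub_kermxP uM u0.
pose d i := \sum_(a < #|D|) (enum_val a == i)%:R * u 0 a.
have dE a : d (enum_val a) = u 0 a.
  rewrite /d (bigD1 a)//= eqxx mul1r big1 ?addr0// => b ba.
  by rewrite (inj_eq enum_val_inj) (negbTE ba) mul0r.
exists d; split.
- have [a ua] : exists a, u 0 a != 0.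
    apply/existsP; apply: contraR u0 => /existsPn u0; apply/eqP/rowP => a.
    by rewrite mxE; have := u0 a; rewrite negbK => /eqP.
  by exists (enum_val a); rewrite dE.
- move=> i; apply: contraR => iD; rewrite /d big1// => a _.
  case: eqP => [ai|_]; last by rewrite mul0r.
  by move: iD; rewrite -ai enum_valP.
- move=> j; have /rowP/(_ j) := uM; rewrite !mxE => uMj; rewrite -[RHS]uMj.
  under eq_bigr do rewrite /d mulr_suml.
  rewrite exchange_big /=; apply: eq_bigr => a _; rewrite mxE.
  rewrite (bigD1 (enum_val a))//= eqxx mul1r big1 ?addr0// => i.
  by rewrite eq_sym => /negbTE ->; rewrite !mul0r.
Qed.

Definition weight_support (R : realType) (N K : nat) (alpha : 'I_N -> 'I_K -> R) :=
  [set ik : 'I_N * 'I_K | alpha ik.1 ik.2 != 0]%SET.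

(* One pivot: move along a dependency of the N + 1 constraint rows in the
   direction that does not decrease the objective, until a weight vanishes. *)
Lemma optimal_pivot (R : realType) (n m N K : nat) (Z : set 'rV[R]_m)
    (c : 'rV[R]_m -> 'rV[R]_m -> R) (zhat : 'I_N -> 'rV[R]_m) (rho : R)
    (l : 'I_K -> 'rV[R]_n -> 'rV[R]_m -> R) (x : 'rV[R]_n)
    (alpha : 'I_N -> 'I_K -> R) v :
  optimal Z c zhat rho l x alpha v -> (N.+1 < #|weight_support alpha|)%N ->
  exists alpha', optimal Z c zhat rho l x alpha' v /\
    weight_support alpha' \proper weight_support alpha.
Proof.
move=> [[a0 Zv arho a1] aopt] ND.
pose C (ik : 'I_N * 'I_K) := c (zhat ik.1 + v ik.1 ik.2) (zhat ik.1).
pose L (ik : 'I_N * 'I_K) := l ik.2 x (zhat ik.1 + v ik.1 ik.2).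
(* Column [ord_max] carries the budget constraint, the other [N] columns the weight sums of the
   samples. *)
pose A (ik : 'I_N * 'I_K) (j : 'I_N.+1) : R :=
  if unlift ord_max j is Some i then (ik.1 == i)%:R else C ik.
have [d0 [[ik0 d0ik0] d0D d0A]] := exists_dependency A ND.
pose s : R := if 0 <= \sum_ik d0 ik * L ik then 1 else -1.
pose d ik := s * d0 ik.
have s0 : s != 0 by rewrite /s; case: ifP => _; rewrite ?oppr_eq0 oner_eq0.
have dik0 : d ik0 != 0 by rewrite mulf_neq0.
have dD ik : d ik != 0 -> alpha ik.1 ik.2 != 0.
  by rewrite mulf_eq0 negb_or => /andP[_ /d0D]; rewrite inE.
have sumd (F : 'I_N * 'I_K -> R) : \sum_ik d ik * F ik = s * \sum_ik d0 ik * F ik.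
  by rewrite mulr_sumr; apply: eq_bigr => ik _; rewrite mulrA.
have dL : 0 <= \sum_ik d ik * L ik.
  rewrite sumd /s; case: (leP 0 (\sum_ik d0 ik * L ik)) => [|/ltW] h.
    by rewrite mul1r.
  by rewrite mulN1r oppr_ge0.
have dC : \sum_ik d ik * C ik = 0.
  rewrite sumd; have := d0A ord_max; rewrite /A unlift_none => ->.
  by rewrite mulr0.
have pairE (F : 'I_N * 'I_K -> R) :
    \sum_(i < N) \sum_(k < K) F (i, k) = \sum_ik F ik.
  by rewrite pair_bigA; apply: eq_bigr => -[].
have d1 i : \sum_(k < K) d (i, k) = 0.
  transitivity (\sum_ik d ik * (ik.1 == i)%:R); last first.
    rewrite sumd; have := d0A (lift ord_max i); rewrite /A liftK => ->.
    by rewrite mulr0.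
  rewrite -(pairE (fun ik => d ik * (ik.1 == i)%:R)) (bigD1 i)//=.
  rewrite [X in _ = _ + X]big1 ?addr0; last first.
    by move=> j ji; rewrite big1// => k _; rewrite (negbTE ji) mulr0.
  by apply: eq_bigr => k _; rewrite eqxx mulr1.
(* The entries of [d] belonging to one sample sum to zero, so a nonzero entry forces a negative
   one. *)
have [ik1 dneg] : exists ik, d ik < 0.
  apply: contrapT => /forallNP nneg.
  have dge ik : 0 <= d ik by rewrite leNgt; apply/negP/nneg.
  have : \sum_(k < K) d (ik0.1, k) != 0.
    rewrite psumr_neq0//; apply/hasP; exists ik0.2; first exact: mem_index_enum.
    rewrite /= lt_neqAle dge andbT eq_sym.
    by move: dik0; case: (ik0).
  by rewrite d1 eqxx.
(* Ratio test: the smallest step at which a decreasing weight reaches zero keeps all weights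
   nonnegative. *)
pose ratio ik := alpha ik.1 ik.2 / - d ik.
case: (@Order.TotalTheory.arg_minP _ _ _ ik1 (fun ik => d ik < 0) ratio dneg) => ik2 d2 min2.
pose t := ratio ik2.
have t0 : 0 <= t by rewrite divr_ge0// oppr_ge0 ltW.
pose alpha' i k := alpha i k + t * d (i, k).
have a'0 i k : 0 <= alpha' i k.
  rewrite /alpha'; have [dp|dn] := leP 0 (d (i, k)).
    by rewrite addr_ge0// mulr_ge0.
  have := min2 _ dn; rewrite -/t /ratio /= ler_pdivlMr ?oppr_gt0//; lra.
have sumE (F : 'I_N * 'I_K -> R) : \sum_(i < N) \sum_(k < K) alpha' i k * F (i, k)
   = \sum_(i < N) \sum_(k < K) alpha i k * F (i, k) + t * \sum_ik d ik * F ik.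
  rewrite -pairE mulr_sumr -big_split; apply: eq_bigr => i _ /=.
  rewrite mulr_sumr -big_split; apply: eq_bigr => k _ /=.
  by rewrite mulrDl mulrA.
exists alpha'; split.
  split.
    split => //.
    - apply: le_trans arho; rewrite (sumE C) dC mulr0 addr0//.
    - by move=> i; rewrite big_split/= -mulr_sumr d1 mulr0 addr0.
  move=> beta w /aopt /le_trans; apply.
  rewrite /objective (sumE L) ler_wpM2l ?invr_ge0 ?ler0n// lerDl mulr_ge0//.
apply/properP; split.
  apply/fintype.subsetP => -[i k]; rewrite !inE /=; apply: contraNN => /eqP aik.
  rewrite /alpha' aik add0r.
  have [->|/dD] := eqVneq (d (i, k)) 0; first by rewrite mulr0.
  by rewrite /= aik eqxx.
exists ik2; first by rewrite inE dD// lt_eqF.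
rewrite inE negbK /alpha' /t /ratio; case: (ik2) d2 => i k /= d2.
by apply/eqP; field; rewrite lt_eqF.
Qed.

Lemma optimal_sparsify (R : realType) (n m N K : nat) (Z : set 'rV[R]_m)
    (c : 'rV[R]_m -> 'rV[R]_m -> R) (zhat : 'I_N -> 'rV[R]_m) (rho : R)
    (l : 'I_K -> 'rV[R]_n -> 'rV[R]_m -> R) (x : 'rV[R]_n)
    (alpha : 'I_N -> 'I_K -> R) v :
  optimal Z c zhat rho l x alpha v ->
  exists alpha', optimal Z c zhat rho l x alpha' v /\
    (#|weight_support alpha'| <= N.+1)%N.
Proof.
move: {2}(#|_|) (leqnn #|weight_support alpha|) => s.
elim: s alpha => [|s IH] alpha.
  by rewrite leqn0 => /eqP s0 oa; exists alpha; rewrite s0.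
move=> hs oa; have [sN|sN] := leqP #|weight_support alpha| N.+1.
  by exists alpha.
have [alpha' [oa' /proper_card lt']] := optimal_pivot oa sN.
by apply: IH oa'; rewrite -ltnS (leq_trans lt').
Qed.

(** * Concavity in the budget, multipliers and dual certificates *)

(** The barycentre of [z1] and [z2] with weights proportional to [p] and [q] works by Jensen's
    inequality; if both weights vanish, any point of [Z] does. *)
Lemma atom_merge (R : realType) (m : nat) (Z : set 'rV[R]_m)
    (g f : 'rV[R]_m -> R) (p q : R) (z1 z2 : 'rV[R]_m) :
  convex_set Z -> convex_function Z g -> convex_function setT (fun z => - f z) ->
  0 <= p -> 0 <= q -> Z z1 -> Z z2 ->
  exists z, [/\ Z z, (p + q) * g z <= p * g z1 + q * g z2
    & p * f z1 + q * f z2 <= (p + q) * f z].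
Proof.
move=> /convex_setE cZ /convex_functionE cg /convex_functionE cf p0 q0 Z1 Z2.
have [pq|pq] := eqVneq (p + q) 0.
  move/eqP: pq; rewrite paddr_eq0// => /andP[/eqP -> /eqP ->].
  by exists z1; split => //; rewrite addr0 !mul0r addr0.
have pq0 : 0 < p + q by rewrite lt_neqAle eq_sym pq addr_ge0.
have s0 : 0 <= p / (p + q) by rewrite divr_ge0// ltW.
have t0 : 0 <= q / (p + q) by rewrite divr_ge0// ltW.
have st : p / (p + q) + q / (p + q) = 1 by rewrite -mulrDl divff.
exists ((p / (p + q)) *: z1 + (q / (p + q)) *: z2); split.
- exact: cZ.
- have := ler_wpM2l (ltW pq0) (cg _ _ _ _ s0 t0 st Z1 Z2) => /le_trans; apply.
  by rewrite le_eqVlt; apply/orP; left; apply/eqP; field.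
- rewrite -lerN2 -mulrN.
  have := ler_wpM2l (ltW pq0) (cf _ _ z1 z2 s0 t0 st I I) => /le_trans; apply.
  by rewrite le_eqVlt; apply/orP; left; apply/eqP; field.
Qed.

(* Concavity of the value of the program in the budget: atoms with the same
   indices are merged, which Jensen's inequality allows for both sums. *)
Lemma feasible_mix (R : realType) (n m N K : nat) (Z : set 'rV[R]_m)
    (c : 'rV[R]_m -> 'rV[R]_m -> R) (zhat : 'I_N -> 'rV[R]_m) (r1 r2 : R)
    (l : 'I_K -> 'rV[R]_n -> 'rV[R]_m -> R) (x : 'rV[R]_n)
    a1 v1 a2 v2 (s t : R) :
  transportation_cost Z c -> convex_set Z -> (forall i, Z (zhat i)) ->
  (forall k, convex_function setT (fun z => - l k x z)) ->
  feasible Z c zhat r1 a1 v1 -> feasible Z c zhat r2 a2 v2 ->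
  0 <= s -> 0 <= t -> s + t = 1 ->
  exists a v, feasible Z c zhat (s * r1 + t * r2) a v /\
    s * objective zhat l x a1 v1 + t * objective zhat l x a2 v2
      <= objective zhat l x a v.
Proof.
move=> hc cZ hz lc [a10 Z1 c1 s1] [a20 Z2 c2 s2] s0 t0 st.
have [zz Hz] := choice (fun ik : 'I_N * 'I_K =>
  atom_merge cZ (cost_convex hc (hz ik.1)) (lc ik.2)
    (mulr_ge0 s0 (a10 ik.1 ik.2)) (mulr_ge0 t0 (a20 ik.1 ik.2))
    (Z1 ik.1 ik.2) (Z2 ik.1 ik.2)).
have zE i k : zhat i + (zz (i, k) - zhat i) = zz (i, k) by rewrite addrC subrK.
have avg (F1 F2 : 'I_N -> 'I_K -> R) :
    s * (N%:R^-1 * \sum_(i < N) \sum_(k < K) F1 i k)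
    + t * (N%:R^-1 * \sum_(i < N) \sum_(k < K) F2 i k)
    = N%:R^-1 * \sum_(i < N) \sum_(k < K) (s * F1 i k + t * F2 i k).
  rewrite !(mulrCA _ N%:R^-1) -mulrDr; congr (_ * _).
  rewrite !mulr_sumr -big_split; apply: eq_bigr => i _ /=.
  by rewrite big_split/= !mulr_sumr.
exists (fun i k => s * a1 i k + t * a2 i k), (fun i k => zz (i, k) - zhat i).
split; first split.
- by move=> i k; rewrite addr_ge0// mulr_ge0.
- by move=> i k; rewrite zE; have [] := Hz (i, k).
- apply: le_trans (lerD (ler_wpM2l s0 c1) (ler_wpM2l t0 c2)).
  rewrite avg ler_wpM2l ?invr_ge0 ?ler0n//.
  apply: ler_sum => i _; apply: ler_sum => k _; rewrite zE.
  by have [_ + _] := Hz (i, k); rewrite !mulrA.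
- by move=> i; rewrite big_split/= -!mulr_sumr s1 s2 !mulr1.
- rewrite /objective avg ler_wpM2l ?invr_ge0 ?ler0n//.
  apply: ler_sum => i _; apply: ler_sum => k _; rewrite zE.
  by have [_ _] := Hz (i, k); rewrite !mulrA.
Qed.

(* An approximate supergradient at [rho] of the value of the program as a
   function of the budget, perturbed to be positive. *)
Lemma exists_multiplier (R : realType) (n m N K : nat)
    (X : set 'rV[R]_n) (Z : set 'rV[R]_m)
    (c : 'rV[R]_m -> 'rV[R]_m -> R) (zhat : 'I_N -> 'rV[R]_m) (rho : R)
    (l : 'I_K -> 'rV[R]_n -> 'rV[R]_m -> R) (x : 'rV[R]_n) alpha v (eta : R) :
  transportation_cost Z c -> (forall i, Z (zhat i)) ->
  0 < rho -> regularity X Z c zhat rho l ->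
  optimal Z c zhat rho l x alpha v -> 0 < eta ->
  exists2 lam, 0 < lam & forall r alpha' v', feasible Z c zhat r alpha' v' ->
    objective zhat l x alpha' v'
      <= objective zhat l x alpha v + eta + lam * (r - rho).
Proof.
move=> hc hz hrho hreg [fav aopt] eta0.
set V := objective zhat l x alpha v in aopt *.
have K0 : (0 < K)%N := ltn_trans (ltn0Sn 0) (reg_K hreg).
pose P r o := exists a w, feasible Z c zhat r a w /\ objective zhat l x a w = o.
have Popt o : P rho o -> o <= V by move=> [a [w [fa <-]]]; exact: aopt.
have P0 r o : P r o -> 0 <= r.
  move=> [a [w [[a0 Zw crho _] _]]]; apply: le_trans crho.
  rewrite mulr_ge0 ?invr_ge0 ?ler0n//; apply: sumr_ge0 => i _.
  by apply: sumr_ge0 => k _; rewrite mulr_ge0// (cost_ge0 hc).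
(* The two points are mixed so that the budget is exactly [rho], where [V] is optimal; cleared of
   denominators, a slope to the right of [rho] is at most a slope to the left. *)
have Pmix r1 o1 r2 o2 : P r1 o1 -> P r2 o2 -> rho < r1 -> r2 < rho ->
    (o1 - V) * (rho - r2) <= (V - o2) * (r1 - rho).
  move=> [a1 [w1 [f1 <-]]] [a2 [w2 [f2 <-]]] lt1 lt2.
  have r12 : 0 < r1 - r2 by lra.
  have s0 : 0 <= (rho - r2) / (r1 - r2) by rewrite divr_ge0; lra.
  have t0 : 0 <= (r1 - rho) / (r1 - r2) by rewrite divr_ge0; lra.
  have st : (rho - r2) / (r1 - r2) + (r1 - rho) / (r1 - r2) = 1.
    by field; rewrite gt_eqF.
  have [a [w []]] := feasible_mix hc (reg_Z_convex hreg) hz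
    (fun k => reg_loss_concave hreg k x) f1 f2 s0 t0 st.
  have -> : (rho - r2) / (r1 - r2) * r1 + (r1 - rho) / (r1 - r2) * r2 = rho.
    by field; rewrite gt_eqF.
  move=> /aopt le1 /le_trans /(_ le1) /(ler_wpM2l (ltW r12)).
  set p1 := objective _ _ _ a1 _; set p2 := objective _ _ _ a2 _.
  have -> : (r1 - r2) * ((rho - r2) / (r1 - r2) * p1 + (r1 - rho) / (r1 - r2) * p2)
    = (rho - r2) * p1 + (r1 - rho) * p2 by field; rewrite gt_eqF.
  lra.
(* These are the slopes to the right of [rho]; adjoining 0 makes the set nonempty and its supremum
   nonnegative. *)
pose E := [set s : R | s = 0 \/ exists r o, [/\ P r o, rho < r & s = (o - V) / (r - rho)]].
have Eub r o : P r o -> r < rho -> ubound E ((V - o) / (rho - r)).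
  move=> Pro lt _ [->|[r1 [ o1 [P1 lt1 ->]]]].
    have [a [w [[a0 Zw crho a1] <-]]] := Pro.
    rewrite divr_ge0 ?subr_ge0 ?(ltW lt)//; apply: aopt; split => //.
    exact: le_trans crho (ltW lt).
  rewrite ler_pdivrMr ?subr_gt0// mulrAC ler_pdivlMr ?subr_gt0//.
  exact: Pmix.
(* Leaving every sample in place uses budget 0, which is below [rho], so a left slope exists and
   bounds [E]. *)
have [q0 Pq0] : exists o, P 0 o.
  have [||a [w fw]] := @feasible_single_atoms R n m N K Z c zhat 0 l x
    (fun=> Ordinal K0) zhat => //.
    by rewrite big1 ?mulr0// => i _; rewrite (cost_diag hc).
  by exists (objective zhat l x a w), a, w; case: fw.
have Esup : has_sup E.
  by split; [exists 0; left|exists ((V - q0) / (rho - 0)); exact: Eub].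
have E0 : 0 <= sup E by apply: sup_upper_bound => //; left.
have er : 0 < eta / rho by rewrite divr_gt0.
(* The extra slope makes the multiplier positive; since [r] is nonnegative, its contribution is at
   least [- eta], which the slack [eta] absorbs. *)
exists (sup E + eta / rho); first by rewrite ltr_wpDl.
move=> r a w faw; set o := objective _ _ _ a w.
have Pro : P r o by exists a, w.
have r0 := P0 _ _ Pro.
have H : o <= V + sup E * (r - rho).
  have [lt|lt|rE] := ltgtP r rho.
  - have : sup E <= (V - o) / (rho - r).
      by apply: ge_sup; [exists 0; left|exact: Eub].
    by rewrite ler_pdivlMr ?subr_gt0//; lra.
  - have : (o - V) / (r - rho) <= sup E.
      by apply: sup_upper_bound => //; right; exists r, o.
    by rewrite ler_pdivrMr ?subr_gt0//; lra.
  - by rewrite rE subrr mulr0 addr0; apply: Popt; rewrite -rE.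
have H2 : eta + eta / rho * (r - rho) = eta / rho * r by field; rewrite gt_eqF.
have := mulr_ge0 (ltW er) r0; lra.
Qed.

(** [S y] is the supremum of loss minus [lam] times cost over all pieces and all points of [Z],
    finite by the growth bound with slope [lam]. Near-maximizers for the samples form a single-atom
    point, feasible for its own budget, to which the multiplier inequality applies. *)
Lemma dual_certificate (R : realType) (n m N K : nat)
    (X : set 'rV[R]_n) (Z : set 'rV[R]_m)
    (c : 'rV[R]_m -> 'rV[R]_m -> R) (zhat : 'I_N -> 'rV[R]_m) (rho : R)
    (l : 'I_K -> 'rV[R]_n -> 'rV[R]_m -> R) (x : 'rV[R]_n) alpha v (eta : R) :
  (0 < N)%N -> transportation_cost Z c -> (forall i, Z (zhat i)) ->
  0 < rho -> regularity X Z c zhat rho l -> X x ->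
  optimal Z c zhat rho l x alpha v -> 0 < eta ->
  exists2 lam, 0 < lam & exists S : 'rV[R]_m -> R,
    (forall i k z, Z z -> l k x z <= lam * c z (zhat i) + S (zhat i)) /\
    N%:R^-1 * \sum_(i < N) S (zhat i) + lam * rho
      <= objective zhat l x alpha v + eta.
Proof.
move=> N0 hc hz hrho hreg hx opt eta0.
have eta2 : 0 < eta / 2 by rewrite divr_gt0.
have [lam lam0 Hlam] := exists_multiplier hc hz hrho hreg opt eta2.
have N1 : (0 : R) < N%:R by rewrite ltr0n.
have K0 : (0 < K)%N := ltn_trans (ltn0Sn 0) (reg_K hreg).
pose E y := [set s : R | exists k z, Z z /\ s = l k x z - lam * c z y].
have Esup y : Z y -> has_sup (E y).
  move=> Zy; split.
    by exists (l (Ordinal K0) x y - lam * c y y), (Ordinal K0), y.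
  have [M HM] := choice (fun k => loss_growth hreg hx k Zy lam0).
  exists (\sum_k `|M k|) => _ [k [z [Zz ->]]].
  have A := HM k z Zz.
  have B : M k <= \sum_k `|M k|.
    by rewrite (bigD1 k)//= (le_trans (ler_norm _))// lerDl sumr_ge0.
  lra.
exists lam => //; exists (fun y => sup (E y)); split.
  move=> i k z Zz; rewrite -lerBlDl.
  by apply: sup_upper_bound; [exact: Esup|exists k, z].
have [kz Hkz] : {kz : 'I_N -> 'I_K * 'rV[R]_m & forall i, Z (kz i).2 /\
    sup (E (zhat i)) - eta / 2 < l (kz i).1 x (kz i).2 - lam * c (kz i).2 (zhat i)}.
  apply: (@choice _ _ (fun i (kz : 'I_K * 'rV[R]_m) => Z kz.2 /\
    sup (E (zhat i)) - eta / 2 < l kz.1 x kz.2 - lam * c kz.2 (zhat i))) => i.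
  have [_ [k [z [Zz ->]]] ?] := sup_adherent eta2 (Esup _ (hz i)).
  by exists (k, z).
have [|a [w [faw oE]]] := @feasible_single_atoms R n m N K Z c zhat
    (N%:R^-1 * \sum_(i < N) c (kz i).2 (zhat i)) l x
    (fun i => (kz i).1) (fun i => (kz i).2) _ (lexx _).
  by move=> i; have [] := Hkz i.
have := Hlam _ _ _ faw; rewrite oE => H1.
have H2 : N%:R^-1 * \sum_(i < N) sup (E (zhat i)) <=
    N%:R^-1 * \sum_(i < N) (l (kz i).1 x (kz i).2 - lam * c (kz i).2 (zhat i)
      + eta / 2).
  rewrite ler_wpM2l ?invr_ge0 ?ler0n//; apply: ler_sum => i _.
  by have [_] := Hkz i; lra.
rewrite big_split/= sumrB -mulr_sumr sumr_const card_ord -(mulr_natl (eta / 2) N) in H2.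
rewrite mulrDr mulKf ?gt_eqF// mulrBr (mulrCA _ lam) in H2.
lra.
Qed.

(** * Integrals, finite mixtures and Borel sets *)

(* No measurability is needed because the integral is defined from suprema over
   simple functions below the positive and negative parts. *)
Lemma le_integral_pointwise (d : measure_display) (T : measurableType d)
    (R : realType) (mu : {measure set T -> \bar R}) (D : set T)
    (f g : T -> \bar R) :
  (forall x, D x -> (f x <= g x)%E) ->
  (\int[mu]_(x in D) f x <= \int[mu]_(x in D) g x)%E.
Proof.
move=> fg; rewrite /integral; apply: leeB; apply: ereal_sup_le => _ [h hf <-];
  exists h => // t; apply: le_trans (hf t) _.
  rewrite !funeposE /patch; case: ifPn => // /set_mem Dt.
  by rewrite ge_max !le_max fg// lexx orbT.
rewrite !funenegE /patch; case: ifPn => // /set_mem Dt.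
by rewrite ge_max !le_max leeN2 fg// lexx orbT.
Qed.

(** The integral formula holds for nonnegative functions by summing scaled Dirac integrals, and for
    signed ones through positive and negative parts. *)
Lemma exists_finite_mixture (d : measure_display) (T : measurableType d)
    (R : realType) (J : finType) (w : J -> R) (p : J -> T) :
  (forall j, 0 <= w j) -> \sum_j w j = 1 ->
  exists Q : probability T R,
    (forall A, Q A = \sum_j (w j)%:E * \d_(p j) A)%E /\
    (forall (D : set T) (f : T -> R), measurable D -> (forall j, D (p j)) ->
      measurable_fun D f ->
      (\int[Q]_(x in D) (f x)%:E)%E = (\sum_j w j * f (p j))%:E).
Proof.
move=> w0 w1.
have [j0 _] : exists j0 : J, true.
  apply: contrapT => /forallNP nJ; move: w1; rewrite big1 => [/eqP|j].
    by rewrite eq_sym oner_eq0.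
  by case: (nJ j).
(* [msum] runs over natural numbers, so [J] is enumerated; the default [j0] exists because the
   weights sum to 1. *)
pose e n := nth j0 (enum J) n.
pose mu : {measure set T -> \bar R} :=
  msum (fun n => mscale (NngNum (w0 (e n))) (\d_(p (e n)))) #|J|.
have sumE (F : J -> \bar R) : (\sum_(n < #|J|) F (e n) = \sum_j F j)%E.
  rewrite [RHS]big_enum_val; apply: eq_bigr => i _.
  by rewrite (enum_val_nth j0).
have muE A : (mu A = \sum_j (w j)%:E * \d_(p j) A)%E.
  by rewrite -sumE.
have mu1 : mu setT = 1%E.
  rewrite muE; under eq_bigr do rewrite diracT mule1.
  by rewrite sumEFin w1.
pose Q : probability T R := HB.pack_for (probability T R) (mu : set T -> \bar R)
  (Measure.class mu) (Measure_isProbability.Build _ _ _ mu mu1).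
exists Q; split => // D f mD Dp mf.
have int0 (g : T -> R) : (forall x, 0 <= g x) -> measurable_fun D g ->
    (\int[mu]_(x in D) (g x)%:E)%E = (\sum_j w j * g (p j))%:E.
  move=> g0 /measurable_EFinP mg.
  have g0' x : D x -> (0 <= (EFin \o g) x)%E by rewrite lee_fin.
  rewrite (ge0_integral_measure_sum _ mD g0' mg) -sumEFin -sumE.
  apply: eq_bigr => n _.
  rewrite (ge0_integral_mscale _ mD _ mg g0')//.
  rewrite (integral_dirac _ mD mg).
  by rewrite diracE mem_set// mul1e.
transitivity (\int[mu]_(x in D) (f x)%:E)%E; first by [].
rewrite integralE.
have -> : (fun x => (f x)%:E)^\+%E = (fun x => (Num.max (f x) 0)%:E).
  by apply/funext => x; rewrite funeposE EFin_max.
have -> : (fun x => (f x)%:E)^\-%E = (fun x => (Num.max (- f x) 0)%:E).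
  by apply/funext => x; rewrite funenegE EFin_max.
rewrite int0; last 2 first.
- by move=> x; rewrite le_max lexx orbT.
- exact: measurable_maxr.
rewrite int0; last 2 first.
- by move=> x; rewrite le_max lexx orbT.
- by apply: measurable_maxr => //; exact: measurableT_comp.
rewrite -EFinB -sumrB; congr (_%:E); apply: eq_bigr => j _.
rewrite -mulrBr; congr (_ * _).
by case: (leP (f (p j)) 0) => h; case: (leP (- f (p j)) 0) => h'; lra.
Qed.

Import HBNNSimple.

(** The integral of a possibly nonmeasurable [g] is a supremum over simple functions below it, and
    the mixture formula evaluates each of those. It is applied to the cost. *)
Lemma mixture_integral_le (d : measure_display) (T : measurableType d)
    (R : realType) (J : finType) (w : J -> R) (p : J -> T)
    (Q : probability T R) (D : set T) (g : T -> R) :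
  (forall (D : set T) (f : T -> R), measurable D -> (forall j, D (p j)) ->
     measurable_fun D f ->
     (\int[Q]_(x in D) (f x)%:E)%E = (\sum_j w j * f (p j))%:E) ->
  (forall j, 0 <= w j) -> (forall j, D (p j)) -> (forall x, D x -> 0 <= g x) ->
  (\int[Q]_(x in D) (g x)%:E <= (\sum_j w j * g (p j))%:E)%E.
Proof.
move=> QE w0 Dp g0; rewrite ge0_integralE; last by move=> x /g0; rewrite lee_fin.
apply: ge_ereal_sup => _ [h /= hg <-].
rewrite -integralT_nnsfun QE//.
rewrite lee_fin; apply: ler_sum => j _.
rewrite ler_wpM2l//; have := hg (p j).
by rewrite /patch mem_set// lee_fin.
Qed.

Lemma open_borel (R : realType) (m : nat) (A : set (borel R m)) :
  open (A : set 'rV[R]_m) -> measurable A.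
Proof. exact: sub_sigma_algebra. Qed.

Lemma closed_borel (R : realType) (m : nat) (A : set (borel R m)) :
  closed (A : set 'rV[R]_m) -> measurable A.
Proof.
move=> cA; rewrite -[A]setCK; apply: measurableC; apply: open_borel.
by rewrite openC.
Qed.

Lemma finite_borel (R : realType) (m : nat) (s : seq 'rV[R]_m) :
  measurable ([set` s] : set (borel R m)).
Proof.
apply: closed_borel; apply: compact_closed; first exact: norm_hausdorff.
by apply: finite_compact; exact: finite_seq.
Qed.

Lemma continuous_borel_measurable (R : realType) (m : nat)
    (f : 'rV[R]_m -> R) :
  continuous f -> measurable_fun (setT : set (borel R m)) f.
Proof.
move=> /continuousP cf; apply: (measurability _ (RGenOpens.measurableE R)).
move=> _ [_ [a [b ->] <-]]; rewrite setTI; apply: open_borel.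
exact/cf/interval_open.
Qed.

(** Change of variables for a pushforward; with [phi] a projection it passes from a marginal to the
    coupling. *)
Lemma integral_marginal (d1 d2 : measure_display) (T1 : measurableType d1)
    (T2 : measurableType d2) (R : realType) (phi : T1 -> T2)
    (mu : {measure set T1 -> \bar R}) (nu : {measure set T2 -> \bar R})
    (D : set T2) (f : T2 -> \bar R) :
  measurable_fun setT phi ->
  (forall A, measurable A -> nu A = mu (phi @^-1` A)) ->
  measurable D -> measurable_fun D f ->
  (\int[nu]_(y in D) f y = \int[mu]_(x in phi @^-1` D) (f \o phi) x)%E.
Proof.
move=> mphi nuE mD mf.
pose phi' : {mfun T1 >-> T2} :=
  HB.pack phi (isMeasurableFun.Build _ _ _ _ _ mphi).
rewrite (eq_measure_integral (pushforward mu phi')); last first.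
  by move=> A mA _; rewrite nuE.
rewrite [LHS]integralE [RHS]integralE (funepos_comp f phi) (funeneg_comp f phi).
congr (_ - _)%E; apply: (ge0_integral_pushforward mphi) => //.
- exact: measurable_funepos.
- exact: measurable_funeneg.
Qed.

Lemma integral_setD_negligible (d : measure_display) (T : measurableType d)
    (R : realType) (mu : {measure set T -> \bar R}) (D B : set T)
    (f : T -> \bar R) :
  measurable D -> measurable B -> mu B = 0%E -> measurable_fun D f ->
  (\int[mu]_(x in D) f x = \int[mu]_(x in D `\` B) f x)%E.
Proof.
move=> mD mB B0 mf; rewrite [LHS]integralE [RHS]integralE.
congr (_ - _)%E; apply: ge0_negligible_integral => //.
- exact: measurable_funepos.
- exact: measurable_funeneg.
Qed.

(** * Weak duality against couplings *)

Lemma loss_fin_num (R : realType) (n m K : nat)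
    (l : 'I_K -> 'rV[R]_n -> 'rV[R]_m -> R) x z :
  (0 < K)%N -> loss l x z \is a fin_num.
Proof.
move=> K0; rewrite fin_numE; apply/andP; split.
  by rewrite gt_eqF// (lt_le_trans (ltNyr (l (Ordinal K0) x z)))// ler_loss.
rewrite lt_eqF// (@le_lt_trans _ _ (\sum_k `|l k x z|)%:E) ?ltry//.
apply: bigmax_le => [|k _]; first exact: leNye.
by rewrite lee_fin (bigD1 k)//= (le_trans (ler_norm _))// lerDl sumr_ge0.
Qed.

Lemma measurable_loss (R : realType) (n m K : nat)
    (l : 'I_K -> 'rV[R]_n -> 'rV[R]_m -> R) x (D : set (borel R m)) :
  (forall k, continuous (l k x)) -> measurable_fun D (loss l x).
Proof.
move=> lc; rewrite /loss; elim: (index_enum 'I_K) => [|k s IH].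
  by under eq_fun do rewrite big_nil; exact: measurable_cst.
under eq_fun do rewrite big_cons; apply: measurable_maxe => //.
apply/measurable_EFinP; apply: (@measurable_funTS _ _ (borel R m)).
exact: continuous_borel_measurable.
Qed.

(* Weak duality; as the cost is not known to be measurable, it enters only through
   the measurable minorant [h] of it off the null set [B]. *)
Lemma expected_loss_le_dual (R : realType) (n m N K : nat) (Z : set 'rV[R]_m)
    (c : 'rV[R]_m -> 'rV[R]_m -> R) (zhat : 'I_N -> 'rV[R]_m)
    (l : 'I_K -> 'rV[R]_n -> 'rV[R]_m -> R) (x : 'rV[R]_n)
    (Q : probability (borel R m) R)
    (gamma : probability (borel R m * borel R m)%type R)
    (lam C : R) (S : 'rV[R]_m -> R) :
  (0 < N)%N -> (0 < K)%N -> closed Z -> (forall i, Z (zhat i)) ->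
  (forall z y, Z z -> Z y -> 0 <= c z y) ->
  (forall k, continuous (l k x)) ->
  Q Z = 1%E -> coupling Q (empirical zhat) gamma ->
  0 < lam ->
  (forall i k z, Z z -> l k x z <= lam * c z (zhat i) + S (zhat i)) ->
  (\int[gamma]_(w in Z `*` Z) (c w.1 w.2)%:E <= C%:E)%E ->
  (expected_loss Z l Q x
    <= (N%:R^-1 * \sum_(i < N) S (zhat i) + lam * C)%:E)%E.
Proof.
move=> N0 K0 cZ hz c0 lc QZ gQ lam0 HS gC.
have N1 : (0 : R) < N%:R by rewrite ltr0n.
have mZ : measurable (Z : set (borel R m)) by exact: closed_borel.
(* Samples may coincide; duplicates are removed so that [g] below counts each sample point once. *)
pose ys := undup [seq zhat i | i : 'I_N].
have ysP i : zhat i \in ys by rewrite mem_undup map_f// mem_enum.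
pose Y : set (borel R m) := [set` ys].
have YE y : Y y -> exists i, y = zhat i.
  by rewrite /Y/= mem_undup => /mapP[i _ ->]; exists i.
have YZ : Y `<=` Z by move=> y /YE[i ->].
have mY : measurable Y by exact: finite_borel.
have mZY : measurable (Z `*` Y : set (borel R m * borel R m)).
  exact: measurableX.
(* The two marginals concentrate [gamma] on the product of [Z] and [Y], so this complement is
   null. *)
pose B : set (borel R m * borel R m) := ~` (Z `*` Y).
have mB : measurable B by exact: measurableC.
have [P [PE Pint]] : exists P : probability (borel R m) R,
    (forall A, P A = empirical zhat A) /\
    (forall (D : set (borel R m)) (f : borel R m -> R), measurable D ->
      (forall i, D (zhat i)) -> measurable_fun D f ->
      (\int[P]_(x in D) (f x)%:E)%E = (\sum_i N%:R^-1 * f (zhat i))%:E).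
  apply: (@exists_finite_mixture _ (borel R m) R 'I_N (fun=> N%:R^-1) zhat).
    by move=> _; rewrite invr_ge0 ler0n.
  by rewrite sumr_const card_ord -[LHS]mulr_natr mulVf// gt_eqF.
have g1 A : measurable A -> Q A = gamma (fst @^-1` A).
  by move=> mA; have [<- _] := gQ _ mA; rewrite setXT.
have g2 A : measurable A -> P A = gamma (snd @^-1` A).
  by move=> mA; have [_] := gQ _ mA; rewrite PE setTX.
have gB : gamma B = 0%E.
  have B1 : gamma (fst @^-1` (~` Z)) = 0%E.
    rewrite -g1; last exact: measurableC.
    by rewrite probability_setC// QZ subee.
  have B2 : gamma (snd @^-1` (~` Y)) = 0%E.
    rewrite -g2; last exact: measurableC.
    rewrite PE /empirical big1// => i _; rewrite diracE memNset ?mule0//=.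
    by move/negP; rewrite ysP.
  have mB1 : measurable (fst @^-1` (~` Z) : set (borel R m * borel R m)).
    by rewrite -[X in measurable X]setTI; apply: measurable_fst => //; exact: measurableC.
  have mB2 : measurable (snd @^-1` (~` Y) : set (borel R m * borel R m)).
    by rewrite -[X in measurable X]setTI; apply: measurable_snd => //; exact: measurableC.
  apply/eqP; rewrite -measure_le0.
  have -> : B = (fst @^-1` (~` Z)) `|` (snd @^-1` (~` Y)).
    apply/seteqP; split => -[a b] /=.
      by move/not_andP.
    by move=> [na [/na]|nb [_ /nb]].
  apply: le_trans (measureU2 _ _ _) _ => //.
  by rewrite [X in (X + _)%E]B1 [X in (_ + X)%E]B2 adde0.
have mell (D : set (borel R m)) : measurable_fun D (loss l x).
  exact: measurable_loss.
pose ell z := fine (loss l x z).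
have ellE z : loss l x z = (ell z)%:E by rewrite fineK// loss_fin_num.
(* A measurable stand-in for [S], with the same values at the samples. *)
pose g (y : borel R m) : R := \sum_(y' <- ys) S y' * \1_[set y'] y.
have gE i : g (zhat i) = S (zhat i).
  rewrite /g (bigD1_seq (zhat i))//= ?undup_uniq// indicE mem_set// mulr1.
  rewrite big1 ?addr0// => y' y'i; rewrite indicE memNset ?mulr0//=.
  by move=> /esym/eqP; rewrite (negbTE y'i).
have mg (D : set (borel R m)) : measurable_fun D g.
  apply: measurable_sum => y'; apply: measurable_funM => //.
  apply: measurable_indic; apply: closed_borel.
  exact: accessible_closed_set1 (hausdorff_accessible (@norm_hausdorff _ _)) _.
have mg2 D : measurable_fun D (g \o snd : borel R m * borel R m -> R).
  by apply: measurable_funTS; exact: measurableT_comp.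
have mell1 D : measurable_fun D (ell \o fst : borel R m * borel R m -> R).
  apply/measurable_EFinP; apply: measurable_funTS.
  rewrite (_ : _ \o _ = loss l x \o fst); last by apply/funext => w /=; rewrite ellE.
  exact: (measurableT_comp (mell setT) measurable_fst).
(* The dual inequality solved for the cost, cut off at 0: this stays below the nonnegative cost, and
   its bounded integral makes it integrable. *)
pose h (w : borel R m * borel R m) := Num.max 0 ((ell w.1 - g w.2) / lam).
have mh D : measurable_fun D h.
  apply: measurable_maxr => //; apply: measurable_funM => //.
  exact: measurable_funB.
have h0 w : 0 <= h w by rewrite le_max lexx.
have ell_le w : Z w.1 -> Y w.2 -> ell w.1 <= lam * c w.1 w.2 + g w.2.
  move=> Z1 /YE[i ->]; rewrite gE -lee_fin -ellE.
  by apply: bigmax_le => [|k _]; rewrite ?leNye// lee_fin HS.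
have hc w : Z w.1 -> Y w.2 -> h w <= c w.1 w.2.
  move=> Z1 Y2; rewrite ge_max c0//=; last exact: YZ.
  by rewrite ler_pdivrMr// lerBlDr mulrC ell_le.
have hC : (\int[gamma]_(w in Z `*` Y) (h w)%:E <= C%:E)%E.
  apply: le_trans gC; rewrite integral_mkcond [leRHS]integral_mkcond.
  apply: le_integral_pointwise => w _; rewrite /patch.
  case: ifPn => [/set_mem[Z1 Y2]|_].
    by rewrite mem_set; [rewrite lee_fin hc|split => //; exact: YZ].
  by case: ifPn => // /set_mem[Z1 Z2]; rewrite lee_fin c0.
have ih : gamma.-integrable (Z `*` Y) (EFin \o h).
  apply/integrableP; split; first exact/measurable_EFinP.
  apply: le_lt_trans (ltry C); apply: le_trans hC.
  by apply: le_integral_pointwise => w _ /=; rewrite ger0_norm.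
have ig D : measurable D -> gamma.-integrable D (EFin \o (g \o snd)).
  move=> mD; apply: measurable_bounded_integrable => //.
    by rewrite (le_lt_trans (probability_le1 _ mD))// ltry.
  exists (\sum_(y' <- ys) `|S y'|); split; first exact: num_real.
  move=> M sM w _ /=; apply: le_trans (ltW sM).
  rewrite (le_trans (ler_norm_sum _ _ _))//; apply: ler_sum => y' _.
  by rewrite normrM ler_piMr// indicE; case: (_ \in _); rewrite ?normr1 ?normr0.
have -> : expected_loss Z l Q x = (\int[gamma]_(w in Z `*` Y) (ell w.1)%:E)%E.
  rewrite /expected_loss (integral_marginal measurable_fst g1)//.
  have mfZ : measurable (fst @^-1` Z : set (borel R m * borel R m)).
    by rewrite -[X in measurable X]setTI; exact: measurable_fst.
  rewrite (integral_setD_negligible mfZ mB gB); last first.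
    by apply: measurable_funTS; exact: measurableT_comp.
  have -> : fst @^-1` Z `\` B = Z `*` Y.
    apply/seteqP; split => w /=; first by move=> [_ /contrapT].
    by move=> [? ?]; split => // nB; apply: nB.
  by apply: eq_integral => w _; rewrite /= ellE.
(* After this bound the integral splits: the [h] part is paid by the transport cost, and the [g]
   part depends on the second marginal only. *)
apply: le_trans (_ : \int[gamma]_(w in Z `*` Y)
    (lam%:E * (h w)%:E + (g w.2)%:E) <= _)%E.
  apply: le_integral_pointwise => w _; rewrite -EFinM -EFinD lee_fin -lerBlDr.
  by rewrite -ler_pdivrMl// mulrC le_max lexx orbT.
rewrite integralD//; last 2 first.
- exact: integrableZl.
- exact: ig.
rewrite integralZl//.
have -> : (\int[gamma]_(w in Z `*` Y) (g w.2)%:E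
    = (N%:R^-1 * \sum_(i < N) S (zhat i))%:E)%E.
  have -> : Z `*` Y = setT `\` B by rewrite setTD setCK.
  rewrite -(integral_setD_negligible measurableT mB gB); last first.
    exact/measurable_EFinP.
  have := @integral_marginal _ _ _ _ R _ gamma P setT (EFin \o g)
    measurable_snd g2 measurableT.
  rewrite preimage_setT => <-; last exact/measurable_EFinP.
  rewrite Pint//; congr (_%:E); rewrite mulr_sumr.
  by apply: eq_bigr => i _; rewrite gE.
rewrite EFinD addeC leeD2l// EFinM.
by apply: lee_wpmul2l => //; rewrite lee_fin ltW.
Qed.

Lemma expected_loss_le_optimal (R : realType) (n m N K : nat)
    (X : set 'rV[R]_n) (Z : set 'rV[R]_m)
    (c : 'rV[R]_m -> 'rV[R]_m -> R) (zhat : 'I_N -> 'rV[R]_m) (rho : R)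
    (l : 'I_K -> 'rV[R]_n -> 'rV[R]_m -> R) (x : 'rV[R]_n) alpha v Q :
  (0 < N)%N -> transportation_cost Z c -> (forall i, Z (zhat i)) ->
  0 < rho -> regularity X Z c zhat rho l -> X x ->
  optimal Z c zhat rho l x alpha v -> ambiguity Z c zhat rho Q ->
  (expected_loss Z l Q x <= (objective zhat l x alpha v)%:E)%E.
Proof.
move=> N0 hc hz hrho hreg hx opt [QZ QOT]; apply/lee_addgt0Pr => e e0.
have K0 : (0 < K)%N := ltn_trans (ltn0Sn 0) (reg_K hreg).
have e2 : 0 < e / 2 by rewrite divr_gt0.
have [lam lam0 [S [HS Sle]]] := dual_certificate N0 hc hz hrho hreg hx opt e2.
(* The infimum over couplings is only approached; the excess is chosen so that [lam] times it is
   [e / 2]. *)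
have : (OT Z c Q (empirical zhat) < (rho + e / 2 / lam)%:E)%E.
  by apply: le_lt_trans QOT _; rewrite lte_fin ltrDl divr_gt0.
move=> /ereal_inf_lt[_ [gamma gQ <-] /ltW gC].
apply: le_trans (expected_loss_le_dual N0 K0 (reg_Z_closed hreg) hz
  (@cost_ge0 _ _ _ _ hc) (@loss_continuous _ _ _ _ _ _ _ _ _ _ _ x hreg) QZ gQ lam0 HS gC) _.
rewrite -EFinD lee_fin mulrDr.
have -> : lam * (e / 2 / lam) = e / 2 by field; rewrite gt_eqF.
lra.
Qed.

(** * From feasible points to distributions *)

(** The mixture of Dirac masses at the pairs of an atom and its sample couples the discrete
    distribution with the empirical one at exactly the budgeted cost. The objective is only a lower
    bound, as each atom is charged one piece of the maximum. *)
Lemma exists_discrete_dist (R : realType) (n m N K : nat)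
    (X : set 'rV[R]_n) (Z : set 'rV[R]_m)
    (c : 'rV[R]_m -> 'rV[R]_m -> R) (zhat : 'I_N -> 'rV[R]_m) (rho : R)
    (l : 'I_K -> 'rV[R]_n -> 'rV[R]_m -> R) (x : 'rV[R]_n) alpha v :
  (0 < N)%N -> transportation_cost Z c -> (forall i, Z (zhat i)) ->
  regularity X Z c zhat rho l -> feasible Z c zhat rho alpha v ->
  exists Q : probability (borel R m) R,
    [/\ forall A, Q A = discrete_dist zhat alpha v A,
        ambiguity Z c zhat rho Q
      & ((objective zhat l x alpha v)%:E <= expected_loss Z l Q x)%E].
Proof.
move=> N0 hc hz hreg [a0 Zv arho a1].
have K0 : (0 < K)%N := ltn_trans (ltn0Sn 0) (reg_K hreg).
have N1 : (0 : R) < N%:R by rewrite ltr0n.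
pose w (ik : 'I_N * 'I_K) : R := N%:R^-1 * alpha ik.1 ik.2.
pose z (ik : 'I_N * 'I_K) : borel R m := zhat ik.1 + v ik.1 ik.2.
have w0 ik : 0 <= w ik by rewrite mulr_ge0 ?invr_ge0 ?ler0n.
have wsum (F : 'I_N * 'I_K -> R) : \sum_ik w ik * F ik =
    N%:R^-1 * \sum_(i < N) \sum_(k < K) alpha i k * F (i, k).
  rewrite pair_bigA mulr_sumr; apply: eq_bigr => -[i k] _ /=.
  by rewrite mulrA.
have w1 : \sum_ik w ik = 1.
  transitivity (\sum_ik w ik * 1); first by apply: eq_bigr => ik _; rewrite mulr1.
  rewrite wsum; under eq_bigr do rewrite -mulr_suml a1 mulr1.
  by rewrite sumr_const card_ord mulVf// gt_eqF.
have [Q [QE Qint]] := exists_finite_mixture z w0 w1.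
have [gamma [gE gint]] := exists_finite_mixture
  (fun ik => (z ik, zhat ik.1) : (borel R m * borel R m)%type) w0 w1.
have mZ : measurable (Z : set (borel R m)) by apply: closed_borel; exact: reg_Z_closed hreg.
exists Q; split.
- by move=> A; rewrite QE /discrete_dist pair_bigA.
- split.
    rewrite QE -[RHS]/(1%:E) -w1 -sumEFin; apply: eq_bigr => ik _.
    by rewrite diracE mem_set ?mule1//; exact: Zv.
  apply: (@le_trans _ _ (\int[gamma]_(w in Z `*` Z) (c w.1 w.2)%:E)%E).
    apply: ereal_inf_lbound; exists gamma => // A mA; split.
      rewrite gE QE; apply: eq_bigr => ik _; congr (_ * _)%E.
      by rewrite !diracE in_setX in_setT andbT.
    rewrite gE /empirical.
    under eq_bigr do rewrite diracE in_setX in_setT /= -EFinM.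
    rewrite sumEFin (wsum (fun ik => (zhat ik.1 \in A)%:R)) mulr_sumr -sumEFin.
    apply: eq_bigr => i _; rewrite diracE -EFinM; congr (_%:E).
    by rewrite /= -mulr_suml a1 mul1r.
  apply: le_trans (mixture_integral_le gint w0 _ _) _.
  + by move=> ik; split; [exact: Zv|exact: hz].
  + by move=> y [? ?]; exact: (cost_ge0 hc).
  + by rewrite lee_fin (wsum (fun ik => c (z ik) (zhat ik.1))).
- have ellE y : loss l x y = (fine (loss l x y))%:E by rewrite fineK// loss_fin_num.
  rewrite /expected_loss; under eq_integral do rewrite ellE.
  rewrite (Qint _ _ mZ (fun ik => Zv ik.1 ik.2)); last first.
    apply/measurable_EFinP; rewrite (_ : _ \o _ = loss l x).
      by apply: measurable_loss; exact: loss_continuous hreg.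
    by apply/funext => y /=; rewrite -ellE.
  rewrite lee_fin wsum ler_wpM2l ?invr_ge0 ?ler0n//.
  apply: ler_sum => i _; apply: ler_sum => k _; apply: ler_wpM2l => //.
  by rewrite -lee_fin -ellE ler_loss.
Qed.

(** * Equality of the two values and the sparse worst-case distribution *)

Unset Implicit Arguments.

Theorem proposition1 (R : realType) (n m N K : nat)
  (X : set 'rV[R]_n) (Z : set 'rV[R]_m)
  (c : 'rV[R]_m -> 'rV[R]_m -> R) (zhat : 'I_N -> 'rV[R]_m) (rho : R)
  (l : 'I_K -> 'rV[R]_n -> 'rV[R]_m -> R)
  (hN : (0 < N)%N)
  (hc : transportation_cost Z c)
  (hzhat : forall i, Z (zhat i))
  (hrho : 0 < rho)
  (hreg : regularity X Z c zhat rho l)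
  (x : 'rV[R]_n) (hx : X x) :
  [/\ ereal_sup [set expected_loss Z l Q x | Q in ambiguity Z c zhat rho]
      = ereal_sup [set (objective zhat l x av.1 av.2)%:E
          | av in [set av : ('I_N -> 'I_K -> R) * ('I_N -> 'I_K -> 'rV[R]_m)
                  | feasible Z c zhat rho av.1 av.2]],
      forall (alpha : 'I_N -> 'I_K -> R) (v : 'I_N -> 'I_K -> 'rV[R]_m),
        optimal Z c zhat rho l x alpha v ->
        exists Q : probability (borel R m) R,
          (forall A : set (borel R m), measurable A ->
             Q A = discrete_dist zhat alpha v A) /\
          worst_case Z c zhat rho l x Q,
      exists (alpha : 'I_N -> 'I_K -> R) (v : 'I_N -> 'I_K -> 'rV[R]_m),
        optimal Z c zhat rho l x alpha v /\
        (#|[pred ik : 'I_N * 'I_K | alpha ik.1 ik.2 != 0%R]| <= N.+1)%N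
    & exists Q : probability (borel R m) R,
        worst_case Z c zhat rho l x Q /\
        exists s : seq 'rV[R]_m, (size s <= N.+1)%N /\ Q [set` s] = 1%E].
Proof.
have upper alpha v Q := @expected_loss_le_optimal R n m N K X Z c zhat rho l x
  alpha v Q hN hc hzhat hrho hreg hx.
have worst alpha v : optimal Z c zhat rho l x alpha v ->
    exists Q : probability (borel R m) R,
      (forall A : set (borel R m), measurable A ->
         Q A = discrete_dist zhat alpha v A) /\
      worst_case Z c zhat rho l x Q.
  move=> opt.
  have [Q [QE Qamb Qle]] := exists_discrete_dist x hN hc hzhat hreg opt.1.
  exists Q; split; first by move=> A _; exact: QE.
  by split => // Q' aQ'; apply: le_trans Qle; exact: upper opt aQ'.
have [alpha0 [v opt0]] := exists_optimal hN hc hzhat hrho hreg hx.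
have [alpha [opt card_alpha]] := optimal_sparsify opt0.
have [Q [QE Qworst]] := worst _ _ opt.
split.
- apply/eqP; rewrite eq_le; apply/andP; split.
    apply: ge_ereal_sup => _ [Q' aQ' <-].
    apply: le_trans (upper _ _ _ opt aQ') _.
    by apply: ereal_sup_ubound; exists (alpha, v) => //; exact: opt.1.
  apply: ge_ereal_sup => _ [[a w] /= faw <-].
  have [Q' [_ aQ' Qle]] := exists_discrete_dist x hN hc hzhat hreg faw.
  by apply: le_trans Qle _; apply: ereal_sup_ubound; exists Q'.
- exact: worst.
- by exists alpha, v; split => //; rewrite -cardsE.
- exists Q; split => //.
  exists [seq zhat ik.1 + v ik.1 ik.2 | ik <- enum (weight_support alpha)].
  split; first by rewrite size_map -cardE.
  rewrite QE; last exact: finite_borel.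
  have [_ _ _ a1] := opt.1.
  (* An atom missing from the list has weight zero, so the listed points carry the total mass. *)
  transitivity (\sum_(i < N) \sum_(k < K) (N%:R^-1 * alpha i k)%:E)%E.
    apply: eq_bigr => i _; apply: eq_bigr => k _; rewrite diracE.
    have [->|aik] := eqVneq (alpha i k) 0; first by rewrite mulr0 mul0e.
    rewrite mem_set ?mule1//=; apply/mapP; exists (i, k) => //.
    by rewrite mem_enum inE.
  under eq_bigr => i _ do rewrite sumEFin -mulr_sumr a1 mulr1.
  by rewrite sumEFin sumr_const card_ord -[X in X%:E]mulr_natr mulVf// pnatr_eq0 -lt0n.
Qed.
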